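(* For every integer $L\ge 0$ and every $\lambda\in\overline{P}^+$, the map $\Phi$ (obtained by iterating the algorithm $\delta$ on rigged configurations of type $E_6^{(1)}$) is a bijection $$\Phi:\mathrm{RC}(\lambda,L)\to\mathcal{P}(\lambda,L)$$ from rigged configurations to classically restricted paths such that $$c(\nu,J)=D(\Phi(\nu,J))\qquad\text{for all }(\nu,J)\in\mathrm{RC}(\lambda,L).$$
   Context: **Root data.** $I=\{0,1,\dots,6\}$, $I_0=\{1,\dots,6\}$. The Dynkin diagram of $E_6^{(1)}$ has edges $1-2$, $2-3$, $3-4$, $4-5$, $3-6$, $6-0$. $(C_{ij})$ is its (symmetric) Cartan matrix: $C_{ii}=2$, $C_{ij}=-1$ if $i,j$ are adjacent (written $i\sim j$), $C_{ij}=0$ otherwise. $\overline{\Lambda}_i$, $\alpha_i$ $(i\in I_0)$ are the fundamental weights and simple roots of $E_6$ (so $\alpha_a=\sum_{b\in I_0}C_{ab}\overline{\Lambda}_b$), $\overline{P}=\bigoplus_{i\in I_0}\mathbb{Z}\overline{\Lambda}_i$, $\overline{P}^+=\bigoplus_{i\in I_0}\mathbb{Z}_{\ge0}\overline{\Lambda}_i$. **The crystal $B=B^{1,1}$.** $B=\{1,2,\dots,27\}$ (elements are called vertices). Write $x\xrightarrow{i}y$ for $f_ix=y$, equivalently $x=e_iy$; when there is no such arrow the value of $f_i$ or $e_i$ is $0$. The arrows are: color 1: $1\to2$, $13\to18$, $14\to19$, $15\to20$, $16\to21$, $17\to22$; color 2: $2\to3$, $10\to13$, $11\to14$, $12\to15$,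 $21\to23$, $22\to24$; color 3: $3\to4$, $8\to10$, $9\to11$, $15\to16$, $20\to21$, $24\to25$; color 4: $4\to5$, $7\to8$, $11\to12$, $14\to15$, $19\to20$, $25\to26$; color 5: $5\to6$, $8\to9$, $10\to11$, $13\to14$, $18\to19$, $26\to27$; color 6: $4\to7$, $5\to8$, $6\to9$, $16\to17$, $21\to22$, $23\to24$; color 0: $17\to1$, $22\to2$, $24\to3$, $25\to4$, $26\to5$, $27\to6$. $B_0$ is the colored directed graph obtained from $B$ by deleting the $0$-arrows. Put $\varepsilon_i(b)=\max\{k\mid e_i^kb\neq0\}$, $\varphi_i(b)=\max\{k\mid f_i^kb\ne0\}$, and $\mathrm{wt}(b)=\sum_{i\in I_0}(\varphi_i(b)-\varepsilon_i(b))\overline{\Lambda}_i$. Tensor products of crystals: $e_i(b_1\otimes b_2)=e_ib_1\otimes b_2$ if $\varphi_i(b_1)\ge\varepsilon_i(b_2)$, and $=b_1\otimes e_ib_2$ otherwise; $\mathrm{wt}(b_1\otimes\cdots\otimes b_L)=\sum_j\mathrm{wt}(b_j)$. **Paths.** $\mathcal{P}(\lambda,L)=\{b\in B^{\otimes L}\mid \mathrm{wt}(b)=\lambda,\ e_ib=0\text{ for all }i\in I_0\}$. (For $L=0$, $B^{\otimes 0}$ consists of the empty path, of weight $0$.) **Energy.** $H:B\otimes B\to\mathbb{Z}$ is the unique function such that $H(1\otimes1)=0$ and, whenever $e_i(b\otimes b')\ne0$ ($i\in I$), $H(e_i(b\otimes b'))=H(b\otimes b')+1$ if $i=0$ and $e_0(b\otimes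 b')=e_0b\otimes b'$; $=H(b\otimes b')-1$ if $i=0$ and $e_0(b\otimes b')=b\otimes e_0b'$; $=H(b\otimes b')$ if $i\neq 0$. Define $D(b_1\otimes\cdots\otimes b_L)=\sum_{j=1}^{L-1}(L-j)H(b_j\otimes b_{j+1})$. **Rigged configurations.** Let $\nu=(m_i^{(a)})_{a\in I_0,i\ge1}$ be a matrix of nonnegative integers, almost all zero, identified with the sequence of partitions $\nu^{(a)}$, where $\nu^{(a)}$ has exactly $m_i^{(a)}$ rows (parts) of length $i$. Vacancy numbers: $$p_i^{(a)}=L\delta_{a1}-\sum_{b\in I_0}C_{ab}\sum_{j\ge1}\min(i,j)m_j^{(b)}.$$ $\nu$ is an admissible configuration for $(\lambda,L)$ if $\sum_{a,i}i\,m_i^{(a)}\alpha_a=L\overline{\Lambda}_1-\lambda$ and $p_i^{(a)}\ge0$ for all $a\in I_0$, $i\geq1$. $\mathrm{RC}(\lambda,L)$ is the set of pairs $(\nu,J)$ with $\nu$ admissible for $(\lambda,L)$ and $J=\{J^{(a,i)}\}$ a family of partitions, $J^{(a,i)}$ having at most $m_i^{(a)}$ parts, each $\le p_i^{(a)}$. Padding $J^{(a,i)}$ by zeros to $m_i^{(a)}$ parts, its parts are attached as labels (''riggings'') to the $m_i^{(a)}$ rows of length $i$ of $\nu^{(a)}$; rows of the same length in the same $\nu^{(a)}$ are not ordered, so only the multiset of (length, rigging) pairs for each $a$ matters. A row of length $i$ in $\nu^{(a)}$ is singular if its rigging equals $p_i^{(a)}$. Charge: $c(\nu,J)=c(\nu)+\sum_{a,i}|J^{(a,i)}|$,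 with $$c(\nu)=\tfrac12\sum_{a,b\in I_0}\sum_{j,k\ge1}C_{ab}\min(j,k)m_j^{(a)}m_k^{(b)}-L\sum_{k\ge1}m_k^{(1)}.$$ **Algorithm $\delta$** (for $L\ge1$, $(\nu,J)\in\mathrm{RC}(\lambda,L)$). Start at the vertex $b=1$ of $B_0$ with $\ell_0=1$. For $j=1,2,\dots$: for each arrow of $B_0$ starting at $b$, say of color $a$, find the minimal integer $i\ge\ell_{j-1}$ such that $\nu^{(a)}$ has a singular row of length $i$ not already selected at an earlier step (singularity is with respect to the original $(\nu,J)$ and its vacancy numbers); the minimum is $\infty$ if there is none. If there are two arrows starting at $b$, use the one with the smaller integer (if the integers are equal and finite, either arrow may be used; the output does not depend on this choice). If the integer obtained is finite, set $\ell_j$ equal to it, select such a row, and replace $b$ by the sink of the arrow. If it is $\infty$, or if no arrow starts at $b$, stop. The final vertex $b$ is $\gamma(\nu,J)\in B$. The new pair $\delta(\nu,J)=(\tilde\nu,\tilde J)$, considered with $L-1$ in place of $L$, is obtained by removing one box from each selected row (a row of length $\ell$ becomes a row of length $\ell-1$; rows of length $0$ are discarded), leaving the riggings of unselected rows unchanged, and giving each shortened row in $\tilde\nu^{(a)}$, of new length $i\ge1$, the rigging $\tilde p_i^{(a)}$, where $\tilde p$ denotes the vacancy numbers computed from $\tilde\nu$ and $L-1$. **The map $\Phi$.** Recursively: for $L=0$, $\Phi$ sends the empty rigged configuration to the empty path; for $L\ge1$, $$\Phi(\nu,J)=\Phi(\delta(\nu,J))\otimes\gamma(\nu,J),$$ where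 $\delta(\nu,J)\in\mathrm{RC}(\lambda-\mathrm{wt}(\gamma(\nu,J)),L-1)$; that $\lambda-\mathrm{wt}(\gamma(\nu,J))$ is dominant and that this membership holds is part of the well-definedness of $\Phi$. *)

(* Defs.v *)
From HB Require Import structures.
From mathcomp Require Import all_boot all_order all_algebra.
From mathcomp Require Import finmap multiset.
From mathcomp Require Import classical_sets.

Set Implicit Arguments.
Unset Strict Implicit.
Unset Printing Implicit Defensive.

Import Order.TTheory GRing.Theory Num.Theory.
Local Open Scope ring_scope.

(* Affine nodes 0, ..., 6 are the elements of 'I_7.  Classical nodes 1, ..., 6
   are indexed by 'I_6, where a : 'I_6 stands for node a + 1. *)
Definition node (a : 'I_6) : 'I_7 := lift ord0 a.

Definition dynkin_edges : seq (nat * nat) :=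
  [:: (1, 2); (2, 3); (3, 4); (4, 5); (3, 6); (6, 0)]%N.

Definition cartan (i j : 'I_7) : int :=
  if i == j then 2
  else if ((val i, val j) \in dynkin_edges) || ((val j, val i) \in dynkin_edges)
  then -1 else 0.

(* Elements of P-bar, in coordinates with respect to the fundamental weights *)
Definition weight := 'rV[int]_6.

Definition Lambda (a : 'I_6) : weight := delta_mx 0 a.

Definition alpha (a : 'I_6) : weight :=
  \sum_b cartan (node a) (node b) *: Lambda b.

Definition dominant (lam : weight) : Prop := forall a, 0 <= lam 0 a.

(* max {k | g^k x <> 0}, with None in the role of 0.  If g has no cycle, then
   x, g x, ..., g^k x are distinct, so that k < #|T|: the bound is harmless. *)
Definition depth (T : finType) (g : T -> option T) (x : T) : nat :=
  \max_(k < #|T| | iter k (obind g) (Some x)) k.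

(* x : vertex stands for the vertex numbered x + 1 in 1, ..., 27. *)
Definition vertex := 'I_27.

(* The triple (i, x, y) is the arrow of color i from x to y. *)
Definition arrows : seq (nat * nat * nat) :=
  [:: (1, 1, 2); (1, 13, 18); (1, 14, 19); (1, 15, 20); (1, 16, 21);
      (1, 17, 22);
      (2, 2, 3); (2, 10, 13); (2, 11, 14); (2, 12, 15); (2, 21, 23);
      (2, 22, 24);
      (3, 3, 4); (3, 8, 10); (3, 9, 11); (3, 15, 16); (3, 20, 21);
      (3, 24, 25);
      (4, 4, 5); (4, 7, 8); (4, 11, 12); (4, 14, 15); (4, 19, 20);
      (4, 25, 26);
      (5, 5, 6); (5, 8, 9); (5, 10, 11); (5, 13, 14); (5, 18, 19);
      (5, 26, 27);
      (6, 4, 7); (6, 5, 8); (6, 6, 9); (6, 16, 17); (6, 21, 22);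
      (6, 23, 24);
      (0, 17, 1); (0, 22, 2); (0, 24, 3); (0, 25, 4); (0, 26, 5);
      (0, 27, 6)]%N.

Definition arrow (i : 'I_7) (x y : vertex) : bool :=
  (val i, (val x).+1, (val y).+1) \in arrows.

Definition f_op (i : 'I_7) (x : vertex) : option vertex :=
  [pick y | arrow i x y].
Definition e_op (i : 'I_7) (y : vertex) : option vertex :=
  [pick x | arrow i x y].

Definition epsilon (i : 'I_7) (b : vertex) : nat := depth (e_op i) b.
Definition phi (i : 'I_7) (b : vertex) : nat := depth (f_op i) b.

Definition wt (b : vertex) : weight :=
  \sum_a ((phi (node a) b)%:Z - (epsilon (node a) b)%:Z) *: Lambda a.

(* The operator e on a tensor product of two crystals, given f and e on the
   left factor and e on the right factor (for a fixed color) *)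
Definition tensor_e (T1 T2 : finType) (f1 e1 : T1 -> option T1)
    (e2 : T2 -> option T2) (b : T1 * T2) : option (T1 * T2) :=
  if (depth e2 b.2 <= depth f1 b.1)%N
  then omap (fun c => (c, b.2)) (e1 b.1)
  else omap (fun c => (b.1, c)) (e2 b.2).

(* The tensor power is bracketed to the right, as B (x) B^{(x) n}. *)
Fixpoint e_tuple (i : 'I_7) (n : nat) {struct n} :
    n.-tuple vertex -> option (n.-tuple vertex) :=
  match n return n.-tuple vertex -> option (n.-tuple vertex) with
  | 0 => fun=> None
  | n'.+1 => fun b =>
      omap (fun p : vertex * n'.-tuple vertex => cons_tuple p.1 p.2)
        (tensor_e (f_op i) (e_op i) (e_tuple i (n := n'))
           (thead b, behead_tuple b))
  end.

Definition wt_tuple (L : nat) (b : L.-tuple vertex) : weight :=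
  \sum_(x <- b) wt x.

Definition paths (lam : weight) (L : nat) : set (L.-tuple vertex) :=
  [set b | wt_tuple b = lam /\ forall a : 'I_6, e_tuple (node a) b = None].

Arguments paths : clear implicits.

Definition is_energy (H : vertex -> vertex -> int) : Prop :=
  let e2 i := tensor_e (f_op i) (e_op i) (e_op i) in
  [/\ H ord0 ord0 = 0,
      forall b b' c, e2 ord0 (b, b') = Some (c, b') -> e_op ord0 b = Some c ->
        H c b' = H b b' + 1,
      forall b b' c', e2 ord0 (b, b') = Some (b, c') -> e_op ord0 b' = Some c' ->
        H b c' = H b b' - 1
    & forall (i : 'I_7) b b' c c', i != ord0 -> e2 i (b, b') = Some (c, c') ->
        H c c' = H b b'].

(* Positions are counted from 0: index j here is j + 1 in 1, ..., L - 1. *)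
Definition energy_D (H : vertex -> vertex -> int) (L : nat)
    (b : L.-tuple vertex) : int :=
  \sum_(j < L.-1) (L - j.+1)%N%:Z * H (nth ord0 b j) (nth ord0 b j.+1).

(* For each a, the multiset of the pairs (length, rigging) of the rows of
   nu^(a), i.e. of the rows of length i labeled by the parts of J^(a,i) padded
   with zeros to m_i^(a) parts *)
Definition rigged := {ffun 'I_6 -> {mset nat * int}}%mset.

(* A sequence of partitions nu^(a); the order in which the parts are listed is
   irrelevant. *)
Definition config := 'I_6 -> seq nat.

Definition shape (nu : rigged) : config := fun a => [seq x.1 | x <- nu a].

(* Sums over j weighted by m_j^(b) are written as sums over the rows. *)
Definition vacancy (L : nat) (nu : config) (a : 'I_6) (i : nat) : int :=
  (L * (a == ord0))%N%:Z
  - \sum_b cartan (node a) (node b) * (\sum_(j <- nu b) minn i j)%:Z.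

Definition admissible (lam : weight) (L : nat) (nu : config) : Prop :=
  \sum_a \sum_(i <- nu a) alpha a *+ i = Lambda ord0 *+ L - lam
  /\ forall a i, (0 < i)%N -> 0 <= vacancy L nu a i.

Definition RC (lam : weight) (L : nat) : set rigged :=
  [set nu : rigged | [/\ forall a x, x \in nu a -> (0 < x.1)%N,
                admissible lam L (shape nu)
              & forall a x, x \in nu a ->
                  0 <= x.2 <= vacancy L (shape nu) a x.1]].

Definition charge_config (L : nat) (nu : config) : rat :=
  2^-1 * (\sum_a \sum_b \sum_(j <- nu a) \sum_(k <- nu b)
            cartan (node a) (node b) * (minn j k)%:Z)%:~R
  - (L * size (nu ord0))%N%:R.

Definition charge (L : nat) (nu : rigged) : rat :=
  charge_config L (shape nu) + (\sum_a \sum_(x <- nu a) x.2)%:~R.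

(* A row is recorded as (a, i), for a row of length i of nu^(a). *)
Definition selection := seq ('I_6 * nat).

(* The minimal i >= l such that nu^(a) has a singular row of length i not in
   sel.  All singular rows of length i of nu^(a) are equal as pairs, so it
   suffices to compare their number with the number of those selected. *)
Definition next_length (L : nat) (nu : rigged) (sel : selection) (l : nat)
    (a : 'I_6) : option nat :=
  ohead (sort leq [seq x.1 | x <- nu a &
    [&& (l <= x.1)%N, x.2 == vacancy L (shape nu) a x.1
      & (count_mem (a, x.1) sel < nu a x)%N]]).

(* The triples (i, a, b') such that b -> b' is an arrow of color a in B_0 whose
   associated integer i is finite and minimal *)
Definition next_steps (L : nat) (nu : rigged) (sel : selection) (l : nat)
    (b : vertex) : seq (nat * 'I_6 * vertex) :=
  let steps := pmap (fun a =>
      if f_op (node a) b is Some b' then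
        omap (fun i => (i, a, b')) (next_length L nu sel l a)
      else None) (enum 'I_6) in
  [seq s <- steps | all (fun s' => s.1.1 <= s'.1.1)%N steps].

(* An arbitrary rule choosing between two arrows with equal integers; it may
   depend on the whole state of the algorithm, which L, nu and the list of the
   rows selected so far determine. *)
Definition tie_break := nat -> rigged -> selection -> bool.

Fixpoint run (tie : tie_break) (L : nat) (nu : rigged) (fuel : nat)
    (b : vertex) (l : nat) (sel : selection) : vertex * selection :=
  if fuel is n.+1 then
    if next_steps L nu sel l b is s :: ss then
      let: (i, a, b') := if tie L nu sel then last s ss else s in
      run tie L nu n b' i ((a, i) :: sel)
    else (b, sel)
  else (b, sel).

(* Every arrow of B_0 goes from a smaller to a larger vertex, so that the run
   stops before the fuel is exhausted. *)
Definition full_run (tie : tie_break) (L : nat) (nu : rigged) :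
    vertex * selection :=
  run tie L nu 27 ord0 1 [::].

Definition gamma (tie : tie_break) (L : nat) (nu : rigged) : vertex :=
  (full_run tie L nu).1.

Definition delta (tie : tie_break) (L : nat) (nu : rigged) : rigged :=
  let sel := (full_run tie L nu).2 in
  let selected a := [seq s.2 | s <- sel & s.1 == a] in
  let shortened a := [seq i.-1 | i <- selected a & (1 < i)%N] in
  let kept a := (nu a `\` seq_mset
    [seq (i, vacancy L (shape nu) a i) | i <- selected a])%mset in
  let nu' : config := fun a => [seq x.1 | x <- kept a] ++ shortened a in
  [ffun a => (kept a `+` seq_mset
    [seq (i, vacancy L.-1 nu' a i) | i <- shortened a])%mset].

Fixpoint Phi (tie : tie_break) (L : nat) (nu : rigged) : L.-tuple vertex :=
  match L return L.-tuple vertex with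
  | 0 => [tuple]
  | n.+1 => rcons_tuple (Phi tie n (delta tie n.+1 nu)) (gamma tie n.+1 nu)
  end.

(* A function satisfying is_energy (see energyP), so that quantifying over the
   functions H with is_energy H is not vacuous.  Row b, column b' of the table
   contains - H(b, b'). *)
Definition energy_table : seq (seq nat) :=
  [:: [:: 0; 1; 1; 1; 1; 1; 1; 1; 1; 1; 1; 1; 1; 1; 1; 1; 1; 2; 2; 2; 2; 2; 2; 2; 2; 2; 2];
     [:: 0; 0; 1; 1; 1; 1; 1; 1; 1; 1; 1; 1; 1; 1; 1; 1; 1; 1; 1; 1; 1; 1; 2; 2; 2; 2; 2];
     [:: 0; 0; 0; 1; 1; 1; 1; 1; 1; 1; 1; 1; 1; 1; 1; 1; 1; 1; 1; 1; 1; 1; 1; 1; 2; 2; 2];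
     [:: 0; 0; 0; 0; 1; 1; 1; 1; 1; 1; 1; 1; 1; 1; 1; 1; 1; 1; 1; 1; 1; 1; 1; 1; 1; 2; 2];
     [:: 0; 0; 0; 0; 0; 1; 1; 1; 1; 1; 1; 1; 1; 1; 1; 1; 1; 1; 1; 1; 1; 1; 1; 1; 1; 1; 2];
     [:: 0; 0; 0; 0; 0; 0; 1; 1; 1; 1; 1; 1; 1; 1; 1; 1; 1; 1; 1; 1; 1; 1; 1; 1; 1; 1; 1];
     [:: 0; 0; 0; 0; 1; 1; 0; 1; 1; 1; 1; 1; 1; 1; 1; 1; 1; 1; 1; 1; 1; 1; 1; 1; 1; 2; 2];
     [:: 0; 0; 0; 0; 0; 1; 0; 0; 1; 1; 1; 1; 1; 1; 1; 1; 1; 1; 1; 1; 1; 1; 1; 1; 1; 1; 2];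
     [:: 0; 0; 0; 0; 0; 0; 0; 0; 0; 1; 1; 1; 1; 1; 1; 1; 1; 1; 1; 1; 1; 1; 1; 1; 1; 1; 1];
     [:: 0; 0; 0; 0; 0; 1; 0; 0; 1; 0; 1; 1; 1; 1; 1; 1; 1; 1; 1; 1; 1; 1; 1; 1; 1; 1; 2];
     [:: 0; 0; 0; 0; 0; 0; 0; 0; 0; 0; 0; 1; 1; 1; 1; 1; 1; 1; 1; 1; 1; 1; 1; 1; 1; 1; 1];
     [:: 0; 0; 0; 0; 0; 0; 0; 0; 0; 0; 0; 0; 1; 1; 1; 1; 1; 1; 1; 1; 1; 1; 1; 1; 1; 1; 1];
     [:: 0; 0; 0; 0; 0; 1; 0; 0; 1; 0; 1; 1; 0; 1; 1; 1; 1; 1; 1; 1; 1; 1; 1; 1; 1; 1; 2];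
     [:: 0; 0; 0; 0; 0; 0; 0; 0; 0; 0; 0; 1; 0; 0; 1; 1; 1; 1; 1; 1; 1; 1; 1; 1; 1; 1; 1];
     [:: 0; 0; 0; 0; 0; 0; 0; 0; 0; 0; 0; 0; 0; 0; 0; 1; 1; 1; 1; 1; 1; 1; 1; 1; 1; 1; 1];
     [:: 0; 0; 0; 0; 0; 0; 0; 0; 0; 0; 0; 0; 0; 0; 0; 0; 1; 1; 1; 1; 1; 1; 1; 1; 1; 1; 1];
     [:: 0; 0; 0; 0; 0; 0; 0; 0; 0; 0; 0; 0; 0; 0; 0; 0; 0; 1; 1; 1; 1; 1; 1; 1; 1; 1; 1];
     [:: 0; 0; 0; 0; 0; 1; 0; 0; 1; 0; 1; 1; 0; 1; 1; 1; 1; 0; 1; 1; 1; 1; 1; 1; 1; 1; 2];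
     [:: 0; 0; 0; 0; 0; 0; 0; 0; 0; 0; 0; 1; 0; 0; 1; 1; 1; 0; 0; 1; 1; 1; 1; 1; 1; 1; 1];
     [:: 0; 0; 0; 0; 0; 0; 0; 0; 0; 0; 0; 0; 0; 0; 0; 1; 1; 0; 0; 0; 1; 1; 1; 1; 1; 1; 1];
     [:: 0; 0; 0; 0; 0; 0; 0; 0; 0; 0; 0; 0; 0; 0; 0; 0; 1; 0; 0; 0; 0; 1; 1; 1; 1; 1; 1];
     [:: 0; 0; 0; 0; 0; 0; 0; 0; 0; 0; 0; 0; 0; 0; 0; 0; 0; 0; 0; 0; 0; 0; 1; 1; 1; 1; 1];
     [:: 0; 0; 0; 0; 0; 0; 0; 0; 0; 0; 0; 0; 0; 0; 0; 0; 1; 0; 0; 0; 0; 1; 0; 1; 1; 1; 1];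
     [:: 0; 0; 0; 0; 0; 0; 0; 0; 0; 0; 0; 0; 0; 0; 0; 0; 0; 0; 0; 0; 0; 0; 0; 0; 1; 1; 1];
     [:: 0; 0; 0; 0; 0; 0; 0; 0; 0; 0; 0; 0; 0; 0; 0; 0; 0; 0; 0; 0; 0; 0; 0; 0; 0; 1; 1];
     [:: 0; 0; 0; 0; 0; 0; 0; 0; 0; 0; 0; 0; 0; 0; 0; 0; 0; 0; 0; 0; 0; 0; 0; 0; 0; 0; 1];
     [:: 0; 0; 0; 0; 0; 0; 0; 0; 0; 0; 0; 0; 0; 0; 0; 0; 0; 0; 0; 0; 0; 0; 0; 0; 0; 0; 0]]%N.

Definition energy (b b' : vertex) : int :=
  - (nth 0%N (nth [::] energy_table b) b')%:Z.

Definition has_in (i y : nat) : bool := has (fun t => (t.1.1 == i) && (t.2 == y)) arrows.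
Definition has_out (i x : nat) : bool := has (fun t => (t.1.1 == i) && (t.1.2 == x)) arrows.

Lemma depth_le1 (T : finType) (g : T -> option T) (x : T) :
  (1 < #|T|)%N -> (forall y, g x = Some y -> g y = None) ->
  depth g x = (g x : bool).
Proof.
rewrite /depth; case: #|T| => // -[//|m] _ g2.
rewrite big_mkcond 2!big_ord_recl /= big1 => [|k _].
  by rewrite max0n maxn0 -[bump 0 0]/1%N /=; case: (g x).
have nilg n : iter n (obind g) None = None by elim: n => //= n ->.
have it2 : iter (val k).+2 (obind g) (Some x) = None.
  rewrite !iterSr /=.
  by case Ex: (g x) => [y|] /=; rewrite ?(g2 _ Ex) nilg.
by case: ifP => //; move: it2; rewrite /= => ->.
Qed.

Lemma arrows_bound t :
  t \in arrows -> [&& t.1.1 < 7, 0 < t.1.2, t.1.2 < 28, 0 < t.2 & t.2 < 28]%N.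
Proof.
by move: t; apply/allP; vm_compute.
Qed.

Lemma e_opP i x y : e_op i y = Some x -> arrow i x y.
Proof. by rewrite /e_op; case: pickP => // z ayz [<-]. Qed.

Lemma e_op_has i y : (e_op i y : bool) = has_in i y.+1.
Proof.
rewrite /e_op; case: pickP => [x axy|noarr] /=; apply/esym.
  by apply/hasP; exists (val i, x.+1, y.+1); rewrite ?eqxx.
apply/negbTE/hasPn => -[[j u] v] tin /=; apply/negP => /andP[/eqP ji /eqP vy].
have /and5P[_ /= u0 u28 _ _] := arrows_bound tin.
have u27 : (u.-1 < 27)%N by rewrite -ltnS prednK.
by move: (noarr (Ordinal u27)); rewrite /arrow /= prednK // -ji -vy tin.
Qed.

Lemma f_op_has i x : (f_op i x : bool) = has_out i x.+1.
Proof.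
rewrite /f_op; case: pickP => [y axy|noarr] /=; apply/esym.
  by apply/hasP; exists (val i, x.+1, y.+1); rewrite ?eqxx.
apply/negbTE/hasPn => -[[j u] v] tin /=; apply/negP => /andP[/eqP ji /eqP ux].
have /and5P[_ /= _ _ v0 v28] := arrows_bound tin.
have v27 : (v.-1 < 27)%N by rewrite -ltnS prednK.
by move: (noarr (Ordinal v27)); rewrite /arrow /= prednK // -ji -ux tin.
Qed.

Lemma strings_le1 :
  all (fun t => ~~ has_in t.1.1 t.1.2 && ~~ has_out t.1.1 t.2) arrows.
Proof. by vm_compute. Qed.

Lemma epsilonE i y : epsilon i y = has_in i y.+1.
Proof.
rewrite /epsilon depth_le1 ?card_ord ?e_op_has // => x /e_opP axy.
have /andP[/= /negP nin _] := allP strings_le1 _ axy.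
by case E: (e_op i x) => //; case: nin; rewrite -e_op_has E.
Qed.

Lemma phiE i x : phi i x = has_out i x.+1.
Proof.
rewrite /phi depth_le1 ?card_ord ?f_op_has // => y.
rewrite {1}/f_op; case: pickP => // z axz [<-].
have /andP[/= _ /negP nout] := allP strings_le1 _ axz.
by case E: (f_op i z) => //; case: nout; rewrite -f_op_has E.
Qed.

Definition table_entry (b b' : nat) : nat :=
  nth 0%N (nth [::] energy_table b) b'.

Lemma energy_check :
  all (fun t : nat * nat * nat =>
    all (fun z =>
      let: (i, x, y) := t in
      ((has_in i z.+1 <= has_out i y)%N ==>
         (table_entry y.-1 z == (i == 0) + table_entry x.-1 z)%N)
      && (~~ (has_in i y <= has_out i z.+1)%N ==>
         (table_entry z x.-1 == (i == 0) + table_entry z y.-1)%N))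
    (iota 0 27)) arrows.
Proof. by vm_compute. Qed.

Lemma energyP : is_energy energy.
Proof.
have chk i (x y z : vertex) : arrow i x y ->
    ((has_in i z.+1 <= has_out i y.+1)%N ->
       energy x z = energy y z + (i == ord0)%:R) /\
    (~~ (has_in i y.+1 <= has_out i z.+1)%N ->
       energy z x = energy z y - (i == ord0)%:R).
  move=> axy; have /allP/(_ (val z)) := allP energy_check _ axy.
  rewrite mem_iota ltn_ord => /(_ isT)/andP[/= /implyP c1 /implyP c2].
  rewrite /energy -!/(table_entry _ _).
  have -> : (i == ord0)%:R = (val i == 0%N)%:Z by rewrite -val_eqE; case: eqP.
  split=> [/c1|/c2] /eqP ->; rewrite PoszD opprD.
    by rewrite addrAC addNr add0r.
  by rewrite addrC.
have main i (b b' c c' : vertex) :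
    tensor_e (f_op i) (e_op i) (e_op i) (b, b') = Some (c, c') ->
    [/\ e_op i b = Some c, c' = b' & energy c b' = energy b b' + (i == ord0)%:R]
    \/ [/\ e_op i b' = Some c', c = b
         & energy b c' = energy b b' - (i == ord0)%:R].
  rewrite /tensor_e /= -/(epsilon i b') -/(phi i b) epsilonE phiE.
  case: ifP => le; last move/negbT: le => le.
    case E: (e_op i b) => [d|] //= [<- <-]; left; split=> //.
    by have [/(_ le)] := chk _ _ _ b' (e_opP E).
  case E: (e_op i b') => [d|] //= [<- <-]; right; split=> //.
  by have [_ /(_ le)] := chk _ _ _ b (e_opP E).
have loop i b : e_op i b <> Some b.
  move=> E; have /andP[/= /negP[]] := allP strings_le1 _ (e_opP E).
  by rewrite -e_op_has E.
split=> //.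
- by move=> b b' c /main[[_ _ ->]//|[E]]; case: (loop _ _ E).
- by move=> b b' c' /main[[E]|[_ _ ->]//]; case: (loop _ _ E).
- move=> i b b' c c' /negPf i0 /main.
  by rewrite i0 => -[[_ -> ->]|[_ -> ->]]; rewrite ?addr0 ?subr0.
Qed.

(* Main.v *)
Require Import Defs.
From mathcomp Require Import all_boot all_order all_algebra.
From mathcomp Require Import classical_sets functions.
From mathcomp Require Import finmap multiset.
From mathcomp Require Import zify ring lra.
Import Order.TTheory GRing.Theory Num.Theory.
Local Open Scope ring_scope.

Set Implicit Arguments.
Unset Strict Implicit.
Unset Printing Implicit Defensive.

(** Everything rests on B being minuscule: the pairing <h_a, wt x> is -1, 0 or 1,
    it is 1 exactly when an arrow of color a leaves x, and -1 exactly when one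
    enters x.

    A run of delta is cut by length.  Let x_i be the vertex reached once all
    steps of length at most i are done, so that x_0 = 1 and x_i = gamma for
    large i.  Removing a box from each selected row changes the vacancy numbers
    into p~_i^(a) = p_i^(a) - <h_a, wt x_i> (vacancy_peel).  So delta is encoded
    by a descending chain (descent) and a splitting of the rows into kept and
    selected ones (peel), and the minimality in the algorithm becomes a
    condition at each length separately: the descent from x_{i-1} to x_i by
    singular rows of length i is greedy (top_saturated).  In these terms the
    algorithm and its inverse, which climbs from b to the vertex 1 by singular
    rows of weakly decreasing lengths, are mirror images.

    Well-definedness: p~_i^(a) can only be negative if p_i^(a) = 0 and
    <h_a, wt x_i> = 1.  Then all rows of length i of nu^(a) were selected, and
    the convexity of the vacancy numbers (vacancy_convex) moves the same defect
    from i to i - 1, hence down to 0, where it contradicts L > 0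
    (no_top_defect).  For the inverse, the defect moves up to infinity, where it
    contradicts the dominance of the weight (no_bot_defect).

    Bijectivity: a greedy walk with given supplies is unique, because the
    off-diagonal Cartan entries are nonpositive (greedy_unique).  Hence the
    chain is determined by the configuration above it (top_unique), which also
    shows that ties do not matter, and by the configuration below it together
    with its last vertex (bot_unique).

    Charge: delta lowers the charge by the number of rows of nu^(1)
    (charge_peel), an identity that reduces to the fact that all weights of B
    have the same length (walk_norm).  It remains to see that the number of rows
    of nu^(1) discarded by delta is -H(gamma(delta nu), gamma(nu)).  Let x and
    x' be the chains of two successive applications of delta.  Then
    H(x'_i, x_{i+1}) does not depend on i (energy_chain): it is minus the number
    of discarded rows for i = 0, and the wanted value for large i.  Passing from
    i to i + 1 is a statement about four vertices of B (local_rule), which is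
    verified exhaustively. *)

Local Notation C a b := (cartan (node a) (node b)).
Local Notation shape := Defs.shape.
Local Notation f_ := (fun a => f_op (node a)).
Local Notation e_ := (fun a => e_op (node a)).

(** * The crystal as a minuscule system *)

(** The pairing of the simple coroot h_a with the weight of x. *)
Definition pairing (a : 'I_6) (x : vertex) : int := wt x 0 a.

Definition pairing_nat (a x : nat) : int :=
  (has_out a.+1 x.+1)%:Z - (has_in a.+1 x.+1)%:Z.

Lemma all_iota0 n (P : pred nat) : all P (iota 0 n) -> forall k : 'I_n, P k.
Proof. by move=> /allP allP k; apply: allP; rewrite mem_iota ltn_ord. Qed.

Lemma val_node (a : 'I_6) : val (node a) = a.+1.
Proof. by []. Qed.

Lemma pairingE a x : pairing a x = pairing_nat a x.
Proof.
rewrite /pairing /wt summxE (bigD1 a) //= big1 => [|b /negPf ba].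
  by rewrite addr0 !mxE !eqxx mulr1 phiE epsilonE.
by rewrite !mxE eq_sym ba andbF mulr0.
Qed.

Definition cartan_nat (i j : nat) : int :=
  if i == j then 2
  else if ((i, j) \in dynkin_edges) || ((j, i) \in dynkin_edges) then -1 else 0.

Lemma cartanE a b : C a b = cartan_nat a.+1 b.+1.
Proof. by []. Qed.

Lemma cartanC a b : C a b = C b a.
Proof. by rewrite !cartanE /cartan_nat eq_sym orbC. Qed.

Lemma cartan_diag a : C a a = 2.
Proof. by rewrite /cartan eqxx. Qed.

Lemma cartan_offdiag a b : a != b -> C a b <= 0.
Proof.
rewrite cartanE /cartan_nat eqSS => /negPf ab.
by rewrite -(inj_eq val_inj) /= in ab; rewrite ab; case: ifP.
Qed.

Lemma f_opP i x y : f_op i x = Some y -> arrow i x y.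
Proof. by rewrite /f_op; case: pickP => // z ayz [<-]. Qed.

Lemma arrow_unique_check :
  all (fun t => all (fun s => (t.1.1 == s.1.1) ==>
    ((t.1.2 == s.1.2) == (t.2 == s.2))) arrows) arrows.
Proof. by vm_compute. Qed.

Lemma arrow_inj i x y x' y' : arrow i x y -> arrow i x' y' -> (x == x') = (y == y').
Proof.
move=> axy axy'; have /allP/(_ _ axy') := allP arrow_unique_check _ axy.
by rewrite eqxx !eqSS -!(inj_eq val_inj) => /eqP.
Qed.

Lemma f_opE i x y : (f_op i x == Some y) = arrow i x y.
Proof.
apply/eqP/idP => [/f_opP//|axy]; rewrite /f_op; case: pickP => [z axz|/(_ y)].
  by have := arrow_inj axy axz; rewrite eqxx => /esym/eqP ->.
by rewrite axy.
Qed.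

Lemma e_opE i x y : (e_op i y == Some x) = arrow i x y.
Proof.
apply/eqP/idP => [/e_opP//|axy]; rewrite /e_op; case: pickP => [z azy|/(_ x)].
  by have := arrow_inj axy azy; rewrite eqxx => /eqP ->.
by rewrite axy.
Qed.

Lemma f_opK i x y : f_op i x = Some y -> e_op i y = Some x.
Proof. by move=> /f_opP axy; apply/eqP; rewrite (e_opE i x y). Qed.

Lemma e_opK i x y : e_op i y = Some x -> f_op i x = Some y.
Proof. by move=> /e_opP axy; apply/eqP; rewrite (f_opE i x y). Qed.

Lemma arrow_weight_check :
  all (fun t => (t.1.1 == 0)%N || all (fun b =>
    pairing_nat b t.2.-1 == pairing_nat b t.1.2.-1 - cartan_nat t.1.1 b.+1)
      (iota 0 6)) arrows.
Proof. by vm_compute. Qed.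

Lemma f_op_pairing a x y :
  f_op (node a) x = Some y -> forall b, pairing b y = pairing b x - C a b.
Proof.
move=> /f_opP axy b; have /all_iota0 H := allP arrow_weight_check _ axy.
by apply/eqP; rewrite !pairingE cartanE; apply: H.
Qed.

Lemma exclusive_check :
  all (fun x => all (fun a => ~~ (has_out a.+1 x.+1 && has_in a.+1 x.+1))
    (iota 0 6)) (iota 0 27).
Proof. by vm_compute. Qed.

Lemma exclusive (a : 'I_6) (x : vertex) :
  has_out a.+1 x.+1 && has_in a.+1 x.+1 = false.
Proof.
exact/negbTE/(all_iota0 (all_iota0 exclusive_check x) a).
Qed.

Lemma f_op_some a x : (f_op (node a) x : bool) = (pairing a x == 1).
Proof.
rewrite f_op_has val_node pairingE /pairing_nat.
by have := exclusive a x; case: has_out; case: has_in.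
Qed.

Lemma e_op_some a x : (e_op (node a) x : bool) = (pairing a x == -1).
Proof.
rewrite e_op_has val_node pairingE /pairing_nat.
by have := exclusive a x; case: has_out; case: has_in.
Qed.

Lemma pairing_range a x : -1 <= pairing a x <= 1.
Proof. by rewrite pairingE /pairing_nat; case: has_out; case: has_in. Qed.

Lemma pairing_top a : pairing a ord0 = (a == ord0)%:R.
Proof.
rewrite pairingE -(inj_eq val_inj) /=.
by case: a => -[|[|[|[|[|[|//]]]]]] /=.
Qed.

Lemma separated_check :
  all (fun x => all (fun y => all (fun a =>
    pairing_nat a x == pairing_nat a y) (iota 0 6) ==> (x == y))
    (iota 0 27)) (iota 0 27).
Proof. by vm_compute. Qed.

Lemma pairing_inj x y : (forall a, pairing a x = pairing a y) -> x = y.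
Proof.
move=> xy; apply/val_inj/eqP.
have /implyP := all_iota0 (all_iota0 separated_check x) y; apply.
apply/allP => a.
rewrite mem_iota /= => a6; apply/eqP.
by have := xy (Ordinal a6); rewrite !pairingE.
Qed.

Lemma arrow_incr_check : all (fun t => (t.1.1 == 0) || (t.1.2 < t.2))%N arrows.
Proof. by vm_compute. Qed.

Lemma f_op_incr a x y : f_op (node a) x = Some y -> (x < y)%N.
Proof. by move=> /f_opP /(allP arrow_incr_check _). Qed.

Lemma source_check :
  all (fun y => (y == 0) || has (fun a => has_in a.+1 y.+1) (iota 0 6))%N
    (iota 0 27).
Proof. by vm_compute. Qed.

Lemma top_of_no_e x : (forall a, pairing a x <> -1) -> x = ord0.
Proof.
move=> no; apply/val_inj/eqP => /=; rewrite -leqn0 leqNgt; apply/negP => x0.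
have := all_iota0 source_check x; rewrite -leqn0 leqNgt x0 => /hasP[a].
rewrite mem_iota /= => a6 ina; case: (no (Ordinal a6)).
by apply/eqP; rewrite -e_op_some e_op_has.
Qed.

(** The properties of a crystal used from here on hold for the lowering
    operators with the pairing and for the raising operators with its opposite;
    an abstract pair (g, h) covers both directions. *)
Section Walks.
Variable g : 'I_6 -> vertex -> option vertex.

Fixpoint walk (x : vertex) (w : seq 'I_6) : option vertex :=
  if w is a :: w' then obind (walk^~ w') (g a x) else Some x.

Lemma walk_cat x w w' : walk x (w ++ w') = obind (walk^~ w') (walk x w).
Proof. by elim: w x => //= a w IH x; case: (g a x) => [y|] /=. Qed.

Lemma walk_rcons x w a : walk x (rcons w a) = obind (g a) (walk x w).
Proof.
by rewrite -cats1 walk_cat; case: (walk x w) => //= y; case: (g a y).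
Qed.

Variable h : 'I_6 -> vertex -> int.

Record minuscule : Prop := Minuscule {
  minuscule_step : forall a x y, g a x = Some y -> forall b, h b y = h b x - C a b;
  minuscule_some : forall a x, (g a x : bool) = (h a x == 1);
  minuscule_le1 : forall a x, h a x <= 1;
  minuscule_inj : forall x y, (forall a, h a x = h a y) -> x = y }.

Hypothesis gh : minuscule.

Lemma walk_weight w x y b : walk x w = Some y ->
  h b y = h b x - \sum_a C a b * (count_mem a w)%:Z.
Proof.
elim: w x => [|c w IH] x /=.
  by case=> ->; rewrite big1 ?subr0 // => a _; rewrite mulr0.
case gcx: (g c x) => [z|] //= /IH ->; rewrite (minuscule_step gh gcx).
rewrite -addrA -opprD; congr (_ - _).
under [RHS]eq_bigr => a _ do rewrite PoszD mulrDr.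
rewrite big_split /= [X in _ = X + _](bigD1 c) //= eqxx mulr1.
rewrite [X in _ = _ + X + _]big1 ?addr0 // => a.
by rewrite eq_sym => /negPf ->; rewrite mulr0.
Qed.

(** Summed over the word, this says that wt x - wt y is orthogonal to
    wt x + wt y, i.e. that x and y have weights of the same length. *)
Lemma walk_norm w x y : walk x w = Some y -> \sum_(a <- w) (h a x + h a y) = 0.
Proof.
elim: w x => [|c w IH] x; first by rewrite big_nil.
rewrite big_cons /=; case gcx: (g c x) => [z|] //= wzy.
have hz := minuscule_step gh gcx.
have -> : \sum_(a <- w) (h a x + h a y) = \sum_(a <- w) (h a z + h a y)
    + \sum_(a <- w) C c a.
  by rewrite -big_split /=; apply: eq_bigr => a _; rewrite hz; ring.
rewrite (IH _ wzy) add0r.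
have := walk_weight c wzy.
have -> : \sum_(a <- w) C c a = \sum_a C a c * (count_mem a w)%:Z.
  elim: (w) => [|d s IHs].
    by rewrite big_nil big1 // => a _; rewrite mulr0.
  rewrite big_cons IHs.
  under [RHS]eq_bigr => a _ do rewrite /= PoszD mulrDr.
  rewrite big_split /= [X in _ = X + _](bigD1 d) //= eqxx mulr1.
  rewrite [X in _ = _ + X + _]big1 ?addr0 1?cartanC // => a.
  by rewrite eq_sym => /negPf ->; rewrite mulr0.
have := hz c; rewrite cartan_diag.
have : h c x = 1 by apply/eqP; rewrite -(minuscule_some gh) gcx.
move=> -> -> ->; ring.
Qed.

(** The outcome of the algorithm at a single length: s is the supply of singular
    rows of that length, and n counts the selected ones. *)
Definition greedy (s : 'I_6 -> nat) (x : vertex) (n : 'I_6 -> nat) (y : vertex) :=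
  (exists2 w, walk x w = Some y & forall a, count_mem a w = n a) /\
  forall a, (n a <= s a)%N /\ (h a y = 1 -> n a = s a).

(** Take the first letter c of the other walk that exceeds the greedy one.  At
    that moment c leaves the current vertex z and is used up to n c < s c times
    on both sides.  The greedy walk used every other color at least as often,
    and off-diagonal Cartan entries are nonpositive, so h_c is at least as large
    at y as at z: the color c can still leave y, against saturation. *)
Lemma greedy_dom s x n y n' y' w' :
  greedy s x n y -> walk x w' = Some y' -> (forall a, count_mem a w' = n' a) ->
  (forall a, n' a <= s a)%N -> forall a, (n' a <= n a)%N.
Proof.
move=> [[w wxy nw] sat] wxy' nw' le a; rewrite -nw'.
elim/last_ind: w' y' n' wxy' nw' le a => // w' c IH y' n'.
rewrite walk_rcons; case Ez: (walk x w') => [z|] //= gcz nw' le.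
have cnt b : (count_mem b (rcons w' c) = count_mem b w' + (c == b))%N.
  by rewrite -cats1 count_cat /= addn0.
have {}IH b : (count_mem b w' <= n b)%N.
  apply: (IH z (fun b => count_mem b w')) => // d.
  by apply: leq_trans (le d); rewrite -nw' cnt leq_addr.
move=> b; rewrite cnt; have [<-|cb] := eqVneq c b; last by rewrite addn0.
rewrite addn1 ltn_neqAle IH andbT; apply/negP => /eqP eqc.
have hz : h c z = 1 by apply/eqP; rewrite -(minuscule_some gh) gcz.
have hy : h c y = 1.
  apply/le_anti; rewrite (minuscule_le1 gh) /=.
  rewrite (walk_weight c wxy) -hz (walk_weight c Ez).
  rewrite lerD2l lerN2; apply: ler_sum => d _; rewrite nw.
  have [->|dc] := eqVneq d c; first by rewrite -eqc.
  by apply: ler_wnM2l; rewrite ?cartan_offdiag // lez_nat IH.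
by have := le c; rewrite -nw' cnt eqxx -((sat c).2 hy) -eqc addn1 ltnn.
Qed.

Lemma greedy_unique s x n y n' y' :
  greedy s x n y -> greedy s x n' y' -> n =1 n' /\ y = y'.
Proof.
move=> G G'.
have [[w wxy nw] sat] := G; have [[w' wxy' nw'] sat'] := G'.
have nn a : n a = n' a.
  apply/eqP; rewrite eqn_leq.
  rewrite (greedy_dom G' wxy nw (fun a => (sat a).1)).
  by rewrite (greedy_dom G wxy' nw' (fun a => (sat' a).1)).
split=> //; apply: (minuscule_inj gh) => b.
rewrite (walk_weight b wxy) (walk_weight b wxy').
by congr (_ - _); apply: eq_bigr => a _; rewrite nw nw' nn.
Qed.

End Walks.

Lemma down_minuscule : minuscule (fun a => f_op (node a)) pairing.
Proof.
split=> [a x y /f_op_pairing//|a x|a x|x y /pairing_inj//].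
  exact: f_op_some.
by case/andP: (pairing_range a x).
Qed.

Lemma up_minuscule : minuscule (fun a => e_op (node a)) (fun a x => - pairing a x).
Proof.
split=> [a x y exy b|a x|a x|x y E].
- by rewrite (f_op_pairing (e_opK exy) b) opprB addrAC subrr sub0r.
- by rewrite e_op_some eqr_oppLR.
- by rewrite lerNl; case/andP: (pairing_range a x).
- by apply: pairing_inj => a; apply: oppr_inj.
Qed.

(** * Vacancy numbers *)

Lemma perm_msetD (K : choiceType) (A B : {mset K}%mset) :
  perm_eq (A `+` B)%mset (A ++ B).
Proof. by apply/allP => x _ /=; rewrite count_cat !count_mem_mset msetE2. Qed.

Lemma vacancy_perm L (nu nu' : config) a i :
  (forall b, perm_eq (nu b) (nu' b)) -> vacancy L nu a i = vacancy L nu' a i.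
Proof.
move=> nunu'; rewrite /vacancy; congr (_ - _); apply: eq_bigr => b _.
by congr (_ * _%:Z); apply: perm_big.
Qed.

Lemma vacancy0 L nu a : vacancy L nu a 0 = (L * (a == ord0))%N%:Z.
Proof.
rewrite /vacancy big1 ?subr0 // => b _.
by rewrite big1 ?mulr0 // => j _; rewrite min0n.
Qed.

(** The second difference of min(-, j) at i + 1 is -1 if j = i + 1 and 0
    otherwise, so the sum over all rows leaves their multiplicities. *)
Lemma vacancy_convex L nu a i :
  vacancy L nu a i + vacancy L nu a i.+2 =
  vacancy L nu a i.+1 *+ 2 + \sum_b C a b * (count_mem i.+1 (nu b))%:Z.
Proof.
rewrite /vacancy.
have E b : ((\sum_(j <- nu b) minn i j)%N%:Z + (\sum_(j <- nu b) minn i.+2 j)%N%:Z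
    = (\sum_(j <- nu b) minn i.+1 j)%N%:Z *+ 2 - (count_mem i.+1 (nu b))%:Z).
  elim: (nu b) => [|k s IH]; first by rewrite !big_nil.
  rewrite !big_cons !PoszD /=.
  have : (minn i k)%:Z + (minn i.+2 k)%:Z = (minn i.+1 k)%:Z *+ 2 - (k == i.+1)%:Z.
    by case: eqP; lia.
  by move: IH; lra.
have -> : \sum_b C a b * (count_mem i.+1 (nu b))%:Z
   = (\sum_b C a b * (\sum_(j <- nu b) minn i.+1 j)%N%:Z) *+ 2
     - \sum_b C a b * (\sum_(j <- nu b) minn i j)%N%:Z
     - \sum_b C a b * (\sum_(j <- nu b) minn i.+2 j)%N%:Z.
  rewrite -sumrMnl -!sumrB; apply: eq_bigr => b _.
  have -> : (count_mem i.+1 (nu b))%:Z = (\sum_(j <- nu b) minn i.+1 j)%N%:Z *+ 2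
    - ((\sum_(j <- nu b) minn i j)%N%:Z + (\sum_(j <- nu b) minn i.+2 j)%N%:Z).
    by rewrite E; ring.
  by ring.
ring.
Qed.

(** The vacancy numbers become constant, equal to the coordinates of the weight,
    beyond the longest row.  This is how the weight condition on configurations
    is used. *)
Definition eventually_vacancy L (nu : config) (lam : weight) :=
  exists N, forall i a, (N <= i)%N -> vacancy L nu a i = lam 0 a.

Lemma vacancy_large L (nu : config) a i :
  (forall b j, j \in nu b -> (j <= i)%N) ->
  vacancy L nu a i
  = (Lambda ord0 *+ L - \sum_b \sum_(i <- nu b) alpha b *+ i) 0 a.
Proof.
move=> le; rewrite /vacancy !mxE summxE; congr (_ - _).
  by rewrite !mulmxnE !mxE /= eq_sym; case: eqP => _ /=; rewrite ?muln0 ?muln1 ?mul0rn ?natz.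
apply: eq_bigr => b _; rewrite summxE (eq_big_seq id) => [|j /le ji]; last exact/minn_idPr.
elim: (nu b) => [|k s IH]; first by rewrite !big_nil mulr0.
rewrite !big_cons PoszD mulrDr IH; congr (_ + _).
rewrite mulmxnE /alpha summxE (bigD1 a) //= big1 => [|c /negPf ca].
  by rewrite !mxE !eqxx mulr1 addr0 cartanC -mulr_natr natz.
by rewrite !mxE eq_sym ca mulr0.
Qed.

Lemma bounded_config (nu : config) :
  exists N, forall b j, j \in nu b -> (j <= N)%N.
Proof.
exists (\max_b \max_(j <- nu b) j)%N => b j jb.
have jmax : (j <= \max_(k <- nu b) k)%N by rewrite (big_rem j jb) /= leq_maxl.
exact: leq_trans jmax (leq_bigmax b).
Qed.

Lemma weight_vacancy L (nu : config) lam :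
  \sum_a \sum_(i <- nu a) alpha a *+ i = Lambda ord0 *+ L - lam <->
  eventually_vacancy L nu lam.
Proof.
have [N leN] := bounded_config nu.
split=> [E|[M EM]].
  exists N => i a Ni; rewrite vacancy_large ?E ?subKr // => b j.
  by move=> /leN jN; apply: leq_trans Ni.
have -> : lam = Lambda ord0 *+ L - \sum_a \sum_(i <- nu a) alpha a *+ i.
  apply/rowP => a; rewrite -(EM (maxn M N)) ?leq_maxl // vacancy_large // => b j.
  by move=> /leN jN; apply: leq_trans (leq_maxr _ _).
by rewrite subKr.
Qed.

(** * Descending chains and the removal of boxes *)

Definition row_label := (nat * int)%type.
Definition rows (r : nat -> int) (s : seq nat) : seq row_label :=
  [seq (i, r i) | i <- s].

Definition shortened (s : seq nat) : seq nat := [seq i.-1 | i <- s & (1 < i)%N].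

(** x i is the vertex reached after the steps of length at most i, and S a lists
    the lengths of the rows of color a that are selected. *)
Record descent (x : nat -> vertex) (S : 'I_6 -> seq nat) : Prop := Descent {
  descent_start : x 0 = ord0;
  descent_pos : forall a, 0%N \notin S a;
  descent_walk : forall i, exists2 w, walk f_ (x i) w = Some (x i.+1)
                          & forall a, count_mem a w = count_mem i.+1 (S a) }.

Definition ends_at (x : nat -> vertex) (b : vertex) :=
  exists N, forall i, (N <= i)%N -> x i = b.

(** K a consists of the kept rows of color a, which are common to nu and nu',
    and the selected rows, of lengths S a, are singular before and after losing
    a box.  The relation is symmetric enough to serve delta and its inverse. *)
Record peel (L : nat) (nu nu' : rigged) (K : 'I_6 -> {mset row_label}%mset)
    (S : 'I_6 -> seq nat) : Prop := Peel {
  peel_top : forall a,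
    nu a = (K a `+` seq_mset (rows (vacancy L (shape nu) a) (S a)))%mset;
  peel_bot : forall a,
    nu' a = (K a `+` seq_mset (rows (vacancy L.-1 (shape nu') a) (shortened (S a))))%mset }.

Lemma count_rows r s i t :
  count_mem (i, t) (rows r s) = ((t == r i) * count_mem i s)%N.
Proof.
elim: s => [|j s IH] /=; first by rewrite muln0.
rewrite IH xpair_eqE mulnDr; congr (_ + _)%N.
have [->|] := eqVneq j i; last by rewrite muln0.
by rewrite muln1 /= eq_sym.
Qed.

Lemma count_shortened s i : (0 < i)%N -> count_mem i (shortened s) = count_mem i.+1 s.
Proof.
move=> i0; rewrite /shortened count_map count_filter; apply: eq_count => -[|[|k]] /=.
- by rewrite andbF.
- by rewrite andbF eqSS eq_sym; case: i i0.
- by rewrite andbT.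
Qed.

(** Shortening a row of length j lowers min(k, j) by one exactly when j <= k. *)
Lemma sum_min_shortened s k : 0%N \notin s ->
  (\sum_(j <- s) minn k j
   = \sum_(j <- shortened s) minn k j + \sum_(j <- s) (j <= k))%N.
Proof.
elim: s => [|j s IH]; first by rewrite !big_nil.
rewrite inE negb_or eq_sym -lt0n => /andP[j0 /IH {}IH].
rewrite !big_cons IH.
have -> : (\sum_(i <- shortened (j :: s)) minn k i
    = minn k j.-1 + \sum_(i <- shortened s) minn k i)%N.
  rewrite /shortened /=; case: (ltnP 1 j) => j1; first by rewrite big_cons.
  by have -> : j = 1%N; rewrite ?minn0 //; lia.
have : (minn k j = minn k j.-1 + (j <= k))%N by lia.
by move=> ->; lia.
Qed.

Lemma count_upto s k : 0%N \notin s ->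
  (\sum_(i < k) count_mem i.+1 s = \sum_(j <- s) (j <= k))%N.
Proof.
elim: s => [|j s IH]; first by rewrite big_nil big1.
rewrite inE negb_or eq_sym -lt0n => /andP[j0 /IH {}IH].
rewrite big_cons -IH big_split /=; congr (_ + _)%N.
case: j j0 => // j _; case: (ltnP j k) => jk.
  rewrite (bigD1 (Ordinal jk)) //= eqxx big1 // => i.
  by rewrite -(inj_eq val_inj) /= eqSS eq_sym => /negPf ->.
by rewrite big1 // => i _; rewrite eqSS gtn_eqF // (leq_trans (ltn_ord i)).
Qed.

Lemma perm_shape (nu : rigged) (K : {mset row_label}%mset) r s a :
  nu a = (K `+` seq_mset (rows r s))%mset ->
  perm_eq (shape nu a) ([seq x.1 | x <- K] ++ s).
Proof.
rewrite /shape => ->; apply: (@perm_trans _ [seq x.1 | x <- K ++ rows r s]).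
  apply: perm_map; apply: perm_trans (perm_msetD _ _) _.
  by rewrite perm_cat2l perm_eq_seq_mset.
by rewrite map_cat -map_comp map_id.
Qed.

Lemma descent_pairing x S i a : descent x S ->
  pairing a (x i.+1) = pairing a (x i) - \sum_b C a b * (count_mem i.+1 (S b))%:Z.
Proof.
move=> D; have [w wx nw] := descent_walk D i.
rewrite (walk_weight down_minuscule a wx); congr (_ - _).
by apply: eq_bigr => b _; rewrite nw cartanC.
Qed.

Lemma weightD (lam : weight) b a : (lam + wt b) 0 a = lam 0 a + pairing a b.
Proof. by rewrite mxE. Qed.

Lemma weightB (lam : weight) b a : (lam - wt b) 0 a = lam 0 a - pairing a b.
Proof. by rewrite !mxE. Qed.

Lemma pairing_descent x S a i : descent x S ->
  pairing a (x i) = (a == ord0)%:R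
    - \sum_b C a b * (\sum_(k < i) count_mem k.+1 (S b))%N%:Z.
Proof.
move=> D; elim: i => [|i IH].
  rewrite (descent_start D) pairing_top big1 ?subr0 // => b _.
  by rewrite big_ord0 mulr0.
rewrite (descent_pairing _ _ D) IH -addrA -opprD -big_split /=.
by congr (_ - _); apply: eq_bigr => b _; rewrite big_ord_recr PoszD mulrDr.
Qed.

(** The rows of color b with length at most i that lose a box are the steps of
    color b on the way from x 0 to x i, so their effect on the vacancy number is
    the change of the pairing along that way; replacing L by L - 1 accounts for
    the pairing at x 0. *)
Lemma vacancy_descent L (nu nu' k : config) x S : (0 < L)%N -> descent x S ->
  (forall a, perm_eq (nu a) (k a ++ S a)) ->
  (forall a, perm_eq (nu' a) (k a ++ shortened (S a))) ->
  forall a i, vacancy L.-1 nu' a i = vacancy L nu a i - pairing a (x i).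
Proof.
move=> L_gt0 D top bot a i; rewrite (pairing_descent _ _ D) /vacancy.
have -> : (L.-1 * (a == ord0))%N%:Z = (L * (a == ord0))%N%:Z - (a == ord0)%:R.
  by case: (L) L_gt0 => // k' _; case: eqP => _ /=; lia.
have E b : (\sum_(j <- nu b) minn i j)%N%:Z
   = (\sum_(j <- nu' b) minn i j)%N%:Z + (\sum_(j < i) count_mem j.+1 (S b))%N%:Z.
  rewrite (perm_big _ (top b)) (perm_big _ (bot b)) /= !big_cat /=.
  rewrite (count_upto _ (descent_pos D b)).
  by rewrite (sum_min_shortened i (descent_pos D b)) addnA !PoszD.
have -> : \sum_b C a b * (\sum_(j <- nu b) minn i j)%N%:Z =
   \sum_b C a b * (\sum_(j <- nu' b) minn i j)%N%:Z +
   \sum_b C a b * (\sum_(j < i) count_mem j.+1 (S b))%N%:Z.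
  by rewrite -big_split /=; apply: eq_bigr => b _; rewrite E mulrDr.
ring.
Qed.

Section Peel.
Variables (L : nat) (nu nu' : rigged) (x : nat -> vertex).
Variables (K : 'I_6 -> {mset row_label}%mset) (S : 'I_6 -> seq nat).
Hypotheses (L_gt0 : (0 < L)%N) (D : descent x S) (P : peel L nu nu' K S).

Local Notation p a i := (vacancy L (shape nu) a i).
Local Notation p' a i := (vacancy L.-1 (shape nu') a i).

Lemma shape_top a : perm_eq (shape nu a) ([seq y.1 | y <- K a] ++ S a).
Proof. exact/perm_shape/(peel_top P). Qed.

Lemma shape_bot a : perm_eq (shape nu' a) ([seq y.1 | y <- K a] ++ shortened (S a)).
Proof. exact/perm_shape/(peel_bot P). Qed.

Lemma vacancy_peel a i : p' a i = p a i - pairing a (x i).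
Proof. exact: vacancy_descent shape_top shape_bot a i. Qed.

Lemma mult_top a i t :
  nu a (i, t) = (K a (i, t) + (t == p a i) * count_mem i (S a))%N.
Proof. by rewrite (peel_top P a) msetE2 mset_seqE count_rows. Qed.

Lemma mult_bot a i t : (0 < i)%N ->
  nu' a (i, t) = (K a (i, t) + (t == p' a i) * count_mem i.+1 (S a))%N.
Proof.
by move=> i0; rewrite (peel_bot P a) msetE2 mset_seqE count_rows count_shortened.
Qed.

Lemma count_shape_top a i :
  (count_mem i (S a) <= count_mem i (shape nu a))%N.
Proof. by rewrite (permP (shape_top a)) count_cat leq_addl. Qed.

Lemma count_shape_bot a i : (0 < i)%N ->
  (count_mem i.+1 (S a) <= count_mem i (shape nu' a))%N.
Proof.
by move=> i0; rewrite (permP (shape_bot a)) count_cat count_shortened // leq_addl.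
Qed.

(** The descent stops at x i although color a could leave it: no singular row
    of length i was kept. *)
Definition top_saturated := forall a i, (0 < i)%N -> pairing a (x i) = 1 ->
  K a (i, p a i) = 0%N.

(** The mirror image, seen from nu': the climb to x i by rows of length i of nu'
    stops there although color a enters x i. *)
Definition bot_saturated := forall a i, (0 < i)%N -> pairing a (x i) = -1 ->
  K a (i, p' a i) = 0%N.

Lemma kept_top a y : y \in K a -> y \in nu a.
Proof. by rewrite (peel_top P a) in_msetD => ->. Qed.

Lemma kept_bot a y : y \in K a -> y \in nu' a.
Proof. by rewrite (peel_bot P a) in_msetD => ->. Qed.

(** A kept row that is singular for nu' would have rigging p + 1 in nu. *)
Lemma RC_bot_saturated lam : RC lam L nu -> bot_saturated.
Proof.
move=> [pos adm rig] a i i0 E; apply/mset_eq0P/negP => /kept_top /rig /=.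
by rewrite vacancy_peel E; lia.
Qed.

(** A kept row that is singular for nu would have rigging p' + 1 in nu'. *)
Lemma RC_top_saturated lam : RC lam L.-1 nu' -> top_saturated.
Proof.
move=> [pos adm rig] a i i0 E; apply/mset_eq0P/negP => /kept_bot /rig /=.
by rewrite vacancy_peel E; lia.
Qed.

Lemma count_shape_singular (mu : rigged) lam M a i : RC lam M mu -> (0 < i)%N ->
  vacancy M (shape mu) a i = 0 -> count_mem i (shape mu a) = mu a (i, 0).
Proof.
move=> [_ _ rig] i0 p0; rewrite -count_mem_mset /shape count_map.
apply: eq_in_count => -[j t] /rig /=; rewrite xpair_eqE.
by have [->|//] := eqVneq j i; rewrite p0; lia.
Qed.

Lemma vacancy_ge0 lam M (mu : rigged) a i : RC lam M mu ->
  0 <= vacancy M (shape mu) a i.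
Proof.
by move=> [_ [_ p0] _]; case: i => [|i]; [rewrite vacancy0|apply: p0].
Qed.

(** If p = 0 at i + 1 all rows of that length are singular, hence selected.
    Convexity then bounds p a i + p a i.+2 by the change of the pairing between
    x i and x i.+1, so that p a i = 0 and the pairing is 1 at x i as well.
    At i = 0 this contradicts p = L > 0. *)
Lemma no_top_defect lam a i : RC lam L nu -> top_saturated ->
  p a i = 0 -> pairing a (x i) <> 1.
Proof.
move=> R sat; elim: i => [|i IH] p0 x1.
  move: p0 x1; rewrite vacancy0 (descent_start D) pairing_top.
  by case: eqP => //= _; lia.
have cnt : count_mem i.+1 (shape nu a) = count_mem i.+1 (S a).
  rewrite (count_shape_singular R) // mult_top p0 eqxx mul1n.
  by rewrite -{1}p0 sat.
have := vacancy_convex L (shape nu) a i; rewrite p0 mul0rn add0r => conv.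
have le : \sum_b C a b * (count_mem i.+1 (shape nu b))%:Z
    <= \sum_b C a b * (count_mem i.+1 (S b))%:Z.
  apply: ler_sum => b _; have [->|ab] := eqVneq b a; first by rewrite cnt.
  by apply: ler_wnM2l; rewrite ?lez_nat ?count_shape_top // cartan_offdiag // eq_sym.
have := descent_pairing i a D; have /andP[_] := pairing_range a (x i).
have := vacancy_ge0 a i R; have := vacancy_ge0 a i.+2 R.
by move=> *; apply: IH; lia.
Qed.

Lemma RC_peel lam b : RC lam L nu -> top_saturated ->
  ends_at x b ->
  dominant (lam - wt b) /\ RC (lam - wt b) L.-1 nu'.
Proof.
move=> R sat [N xb].
have p'0 a i : 0 <= p' a i.
  rewrite vacancy_peel; have := vacancy_ge0 a i R; have := pairing_range a (x i).
  by have := @no_top_defect lam a i R sat; lia.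
have [pos [/weight_vacancy [M pM] p0] rig] := R.
have p'E i a : (maxn M N <= i)%N -> p' a i = (lam - wt b) 0 a.
  rewrite geq_max => /andP[Mi Ni].
  by rewrite vacancy_peel pM // xb // weightB.
split; first by move=> a; rewrite -(p'E (maxn M N)).
split.
- move=> a y; rewrite (peel_bot P a) in_msetD => /orP[/kept_top/pos//|].
  rewrite (perm_mem (perm_eq_seq_mset _)) => /mapP[i /mapP[j]].
  by rewrite mem_filter => /andP[j1 _] -> -> /=; lia.
- split=> [|a i _]; last exact: p'0.
  by apply/weight_vacancy; exists (maxn M N) => i a; apply: p'E.
- move=> a [i t]; rewrite (peel_bot P a) in_msetD => /orP[Ky|]; last first.
    rewrite (perm_mem (perm_eq_seq_mset _)) => /mapP[j _ [-> ->]].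
    by rewrite lexx p'0.
  have := rig a _ (kept_top Ky); have := pos a _ (kept_top Ky) => /= i0.
  rewrite vacancy_peel; have := pairing_range a (x i).
  have : pairing a (x i) = 1 -> t <> p a i.
    by move=> x1 tE; move: Ky; rewrite tE in_mset (sat _ _ i0 x1).
  lia.
Qed.

(** The same argument with the roles of nu and nu' exchanged pushes the defect
    to larger and larger lengths, where it makes a coordinate of lam + wt b
    negative. *)
Lemma no_bot_defect lam b a i : RC lam L.-1 nu' -> bot_saturated ->
  ends_at x b -> dominant (lam + wt b) ->
  (0 < i)%N -> p' a i = 0 -> pairing a (x i) <> -1.
Proof.
move=> R sat [N xb] dom i0 p0 x1.
have [_ [/weight_vacancy [M pM] _] _] := R.
suff far k : p' a (i + k)%N = 0 /\ pairing a (x (i + k)%N) = -1.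
  have [] := far (maxn M N); rewrite pM ?xb; try lia.
  by have := dom a; rewrite weightD; lia.
elim: k => [|k [IHp IHx]]; first by rewrite addn0.
case: i i0 {p0 x1} IHp IHx => // i _; rewrite addnS addSn.
move: (i + k)%N => j p0 x1.
have cnt : count_mem j.+1 (shape nu' a) = count_mem j.+2 (S a).
  rewrite (count_shape_singular R) // mult_bot // p0 eqxx mul1n.
  by rewrite -{1}p0 sat.
have := vacancy_convex L.-1 (shape nu') a j; rewrite p0 mul0rn add0r => conv.
have le : \sum_b C a b * (count_mem j.+1 (shape nu' b))%:Z
    <= \sum_b C a b * (count_mem j.+2 (S b))%:Z.
  apply: ler_sum => c _; have [->|ac] := eqVneq c a; first by rewrite cnt.
  by apply: ler_wnM2l; rewrite ?lez_nat ?count_shape_bot // cartan_offdiag // eq_sym.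
have := descent_pairing j.+1 a D; have /andP[ge _] := pairing_range a (x j.+2).
have := vacancy_ge0 a j R; have := vacancy_ge0 a j.+2 R.
by move=> *; split; lia.
Qed.

Lemma RC_unpeel lam b : RC lam L.-1 nu' -> bot_saturated ->
  ends_at x b -> dominant (lam + wt b) ->
  RC (lam + wt b) L nu.
Proof.
move=> R sat eN dom; have [N xb] := eN.
have p'p a i : p a i = p' a i + pairing a (x i) by rewrite vacancy_peel subrK.
have pge0 a i : (0 < i)%N -> 0 <= p a i.
  move=> i0; rewrite p'p; have := vacancy_ge0 a i R; have := pairing_range a (x i).
  by have := no_bot_defect R sat eN dom i0 (a := a); lia.
have [pos [/weight_vacancy [M pM] p0] rig] := R.
split.
- move=> a y; rewrite (peel_top P a) in_msetD => /orP[/kept_bot/pos//|].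
  rewrite (perm_mem (perm_eq_seq_mset _)) => /mapP[[|i] // + ->] //.
  by rewrite (negPf (descent_pos D a)).
- split=> [|a i]; last exact: pge0.
  apply/weight_vacancy; exists (maxn M N) => i a.
  by rewrite geq_max => /andP[Mi Ni]; rewrite p'p pM // xb // weightD.
- move=> a [i t]; rewrite (peel_top P a) in_msetD => /orP[Ky|]; last first.
    rewrite (perm_mem (perm_eq_seq_mset _)) => /mapP[[|j] + [-> ->]].
      by rewrite (negPf (descent_pos D a)).
    by rewrite lexx pge0.
  have := rig a _ (kept_bot Ky); have := pos a _ (kept_bot Ky) => /= i0.
  rewrite p'p; have := pairing_range a (x i).
  have : pairing a (x i) = -1 -> t <> p' a i.
    by move=> x1 tE; move: Ky; rewrite tE in_mset (sat _ _ i0 x1).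
  lia.
Qed.

End Peel.

(** * The run of the algorithm as a greedy chain *)

Definition singular L (nu : rigged) a i : nat := nu a (i, vacancy L (shape nu) a i).

(** The lengths among which next_length takes the minimum. *)
Definition available L nu (sel : selection) l a j : bool :=
  (l <= j)%N && (count_mem (a, j) sel < singular L nu a j)%N.

Lemma ohead_sort (s : seq nat) :
  if ohead (sort leq s) is Some i then i \in s /\ (forall j, j \in s -> (i <= j)%N)
  else s = [::].
Proof.
case E: (sort leq s) => [|i t] /=.
  by apply/nilP; rewrite /nilp -(size_sort leq) E.
have m j : (j \in s) = (j \in i :: t) by rewrite -E mem_sort.
split=> [|j]; first by rewrite m mem_head.
have /= := sort_sorted leq_total s; rewrite E /= (path_sortedE leq_trans).
by move=> /andP[/allP le _]; rewrite m inE => /predU1P[->|/le].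
Qed.

Lemma next_lengthP L nu sel l a :
  if next_length L nu sel l a is Some i
  then available L nu sel l a i /\ forall j, available L nu sel l a j -> (i <= j)%N
  else forall j, ~~ available L nu sel l a j.
Proof.
rewrite /next_length; set s := [seq x.1 | x <- _ & _].
have m j : (j \in s) = available L nu sel l a j.
  apply/mapP/idP => [[[k t]]|/andP[lj cj]].
    by rewrite mem_filter /= => /andP[/and3P[lk /eqP -> ck] _] ->; apply/andP.
  exists (j, vacancy L (shape nu) a j) => //; rewrite mem_filter /= lj eqxx cj /=.
  by rewrite in_mset (leq_ltn_trans _ cj).
have := ohead_sort s; case: ohead => [i [mi le]|s0 j]; last by rewrite -m s0.
by split=> [|j]; rewrite -m //; apply: le.
Qed.

(** A finite nonempty list has minimal elements, so next_steps is only empty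
    when no arrow has a finite integer. *)
Lemma min_exists (T : eqType) (k : T -> nat) (s : seq T) :
  [seq t <- s | all (fun t' => k t <= k t')%N s] = [::] -> s = [::].
Proof.
move=> H; apply/eqP; case: s H => // t0 s; set s' := t0 :: s => H; exfalso.
have ex : exists n, has (fun t => k t == n) s'.
  by exists (k t0); rewrite /= eqxx.
have [_ /hasP[t ts /eqP <-] le] := ex_minnP ex.
suff : t \in [::] by [].
rewrite -H mem_filter ts andbT; apply/allP => u us; apply: le.
by apply/hasP; exists u.
Qed.

Lemma next_stepsP L nu sel l b :
  if next_steps L nu sel l b is s :: ss
  then forall i a b', (i, a, b') \in s :: ss ->
    [/\ f_op (node a) b = Some b', available L nu sel l a i
      & forall c j, (j < i)%N -> pairing c b = 1 -> ~~ available L nu sel l c j]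
  else forall c j, pairing c b = 1 -> ~~ available L nu sel l c j.
Proof.
rewrite /next_steps; set steps := pmap _ _.
have mem i a b' : ((i, a, b') \in steps) =
    (f_op (node a) b == Some b') && (next_length L nu sel l a == Some i).
  rewrite mem_pmap; apply/mapP/andP => [[c _]|[/eqP fb /eqP nl]].
    case fb: f_op => [b1|//]; case nl: next_length => [i1|//] [-> -> ->].
    by rewrite fb nl !eqxx.
  by exists a; rewrite ?mem_enum // fb nl.
have out c : pairing c b = 1 -> exists b', f_op (node c) b = Some b'.
  by move/eqP; rewrite -f_op_some; case: f_op => // b'; exists b'.
case E: [seq _ <- _ | _] => [|s ss].
  move: E => /min_exists steps0 c j /out[b' fb].
  have := next_lengthP L nu sel l c; case nl: next_length => [i|//] _.
  by move: (mem i c b'); rewrite steps0 fb nl !eqxx.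
move=> i a b'; rewrite -E mem_filter mem => /andP[/allP min /andP[/eqP fb /eqP nl]].
have := next_lengthP L nu sel l a; rewrite nl => -[av _]; split=> // c j ji.
move=> /out[c' fc]; have := next_lengthP L nu sel l c.
case nlc: next_length => [k|//] [_ le]; apply/negP => /le kj.
have := min (k, c, c'); rewrite mem fc nlc !eqxx => /(_ isT) /= ik.
by have := leq_trans (leq_ltn_trans kj ji) ik; rewrite ltnn.
Qed.

Definition lengths (sel : selection) a : seq nat := [seq s.2 | s <- sel & s.1 == a].

Lemma count_lengths sel a i : count_mem i (lengths sel a) = count_mem (a, i) sel.
Proof.
rewrite count_map count_filter; apply: eq_count => -[b j] /=.
by rewrite xpair_eqE andbC.
Qed.

Definition colors_upto (sel : selection) i : seq 'I_6 :=
  rev [seq s.1 | s <- sel & (s.2 <= i)%N].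

Definition vertex_at (sel : selection) i : vertex :=
  odflt ord0 (walk f_ ord0 (colors_upto sel i)).

Lemma sorted_split (sel : selection) i : sorted geq [seq s.2 | s <- sel] ->
  sel = [seq s <- sel | (i < s.2)%N] ++ [seq s <- sel | (s.2 <= i)%N].
Proof.
elim: sel => //= s sel IH; rewrite (path_sortedE (rev_trans leq_trans)).
move=> /andP[/allP le srt]; case: ltnP => si /=; first by congr (_ :: _); apply: IH.
have -> : [seq t <- sel | (t.2 <= i)%N] = sel.
  apply/all_filterP/allP => t ts; apply: leq_trans si.
  by apply: le; apply: map_f.
rewrite (eq_in_filter (a2 := pred0)) ?filter_pred0 // => t ts.
by apply/negbTE; rewrite -leqNgt; apply: leq_trans si; apply: le; apply: map_f.
Qed.

(** Selections are stored with the latest step first, whence the reversed words.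
    Saturation is only claimed below the current length l: rows of length l may
    still be selected. *)
Record run_invariant L nu (b : vertex) l (sel : selection) : Prop := RunInvariant {
  inv_walk : walk f_ ord0 (rev [seq s.1 | s <- sel]) = Some b;
  inv_sorted : sorted geq [seq s.2 | s <- sel];
  inv_range : forall s, s \in sel -> (0 < s.2 <= l)%N;
  inv_count : forall a i, (count_mem (a, i) sel <= singular L nu a i)%N;
  inv_sat : forall a i, (0 < i < l)%N -> pairing a (vertex_at sel i) = 1 ->
    (singular L nu a i <= count_mem (a, i) sel)%N }.

Lemma vertex_at_last L nu b l sel i : run_invariant L nu b l sel -> (l <= i)%N ->
  vertex_at sel i = b.
Proof.
move=> I li; rewrite /vertex_at /colors_upto.
have /all_filterP -> : all (fun s : 'I_6 * nat => (s.2 <= i)%N) sel.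
  by apply/allP => s /(inv_range I) /andP[_ sl]; apply: leq_trans li.
by rewrite (inv_walk I).
Qed.

(** The numbering of vertices increases along arrows, so b + fuel never drops
    below 27 and the run cannot end by lack of fuel. *)
Lemma run_invariantP tie L nu fuel (b : vertex) l sel : (27 <= b + fuel)%N -> (0 < l)%N ->
  run_invariant L nu b l sel ->
  let: (b', sel') := run tie L nu fuel b l sel in
  exists2 l', run_invariant L nu b' l' sel' &
    forall a i, (0 < i)%N -> pairing a (vertex_at sel' i) = 1 ->
      (singular L nu a i <= count_mem (a, i) sel')%N.
Proof.
elim: fuel b l sel => [|fuel IH] b l sel; first by rewrite addn0 leqNgt ltn_ord.
move=> fuel_ok l0 I /=.
have := next_stepsP L nu sel l b; case: next_steps => [stop|s ss /= next].
  exists l => // a i i0; case: (ltnP i l) => il; first by apply: (inv_sat I); rewrite i0.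
  rewrite (vertex_at_last I il) => /(stop a i).
  by rewrite /available il /= -leqNgt.
have : (if tie L nu sel then last s ss else s) \in s :: ss.
  by case: ifP; rewrite ?mem_last ?mem_head.
move: (if _ then _ else _) => [[i a] b'] /next [fb /andP[li cnt] sat].
have small j : (j < i)%N -> vertex_at ((a, i) :: sel) j = vertex_at sel j.
  by move=> ji; rewrite /vertex_at /colors_upto /= leqNgt ji.
have i0 : (0 < i)%N := leq_trans l0 li.
apply: IH => //.
  by have := f_op_incr fb; lia.
split.
- by rewrite /= rev_cons walk_rcons (inv_walk I).
- rewrite /= (path_sortedE (rev_trans leq_trans)) (inv_sorted I) andbT.
  apply/allP => _ /mapP[t /(inv_range I)/andP[_ tl] ->].
  exact: leq_trans li.
- move=> t; rewrite inE => /predU1P[->/=|/(inv_range I)/andP[-> tl]].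
    by rewrite i0 leqnn.
  exact: leq_trans li.
- move=> c j /=; case: eqP => [[<- <-]|_]; first by rewrite add1n.
  exact: (inv_count I).
- move=> c j /andP[j0 ji]; rewrite small // /= xpair_eqE (gtn_eqF ji) andbF add0n.
  case: (ltnP j l) => jl; first by apply: (inv_sat I); rewrite j0.
  rewrite (vertex_at_last I jl) => /(sat c j ji).
  by rewrite /available jl /= -leqNgt.
Qed.

Lemma full_runP tie L nu : exists l, exists2 sel,
  full_run tie L nu = (gamma tie L nu, sel) &
  run_invariant L nu (gamma tie L nu) l sel /\
    forall a i, (0 < i)%N -> pairing a (vertex_at sel i) = 1 ->
      (singular L nu a i <= count_mem (a, i) sel)%N.
Proof.
have I0 : run_invariant L nu ord0 1 [::].
  by split=> // a i /andP[]; case: i.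
have := @run_invariantP tie L nu 27 ord0 1 [::] isT isT I0.
rewrite /gamma /full_run; case: run => b sel [l I sat].
by exists l, sel.
Qed.

Lemma vertex_at_descent L nu b l sel : run_invariant L nu b l sel ->
  descent (vertex_at sel) (lengths sel).
Proof.
move=> I; have srt := inv_sorted I.
have pos a : 0%N \notin lengths sel a.
  apply/mapP => -[s]; rewrite mem_filter => /andP[_ /(inv_range I)].
  by case: s.2.
have walkto i : walk f_ ord0 (colors_upto sel i) = Some (vertex_at sel i).
  have := inv_walk I; rewrite {1}(sorted_split i srt) map_cat rev_cat walk_cat.
  by rewrite /vertex_at /colors_upto; case: walk.
split=> // [|i].
  rewrite /vertex_at /colors_upto (eq_in_filter (a2 := pred0)) ?filter_pred0 //.
  by move=> s /(inv_range I); case: s.2.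
exists (rev [seq s.1 | s <- sel & s.2 == i.+1]); last first.
  move=> a; rewrite count_rev count_map count_filter count_lengths.
  by apply: eq_count => -[c j]; rewrite /= xpair_eqE.
have := walkto i.+1; rewrite {1}/colors_upto.
have /(sorted_split i) -> : sorted geq [seq s.2 | s <- sel & (s.2 <= i.+1)%N].
  rewrite -(filter_map (fun s : 'I_6 * nat => s.2) (fun j => j <= i.+1)%N).
  exact: sorted_filter (rev_trans leq_trans) _ _ srt.
rewrite map_cat rev_cat -!filter_predI walk_cat.
have -> : [seq x <- sel | predI (fun s => (s.2 <= i)%N) (fun s => (s.2 <= i.+1)%N) x]
   = [seq s <- sel | (s.2 <= i)%N].
  by apply: eq_filter => s /=; lia.
have -> : [seq x <- sel | predI (fun s => (i < s.2)%N) (fun s => (s.2 <= i.+1)%N) x]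
   = [seq s <- sel | s.2 == i.+1].
  by apply: eq_filter => s /=; lia.
by rewrite -/(colors_upto sel i) walkto.
Qed.

(** The description of delta from which the bijection and the charge formula are
    derived. *)
Lemma delta_spec tie L nu : exists x K S,
  [/\ descent x S, peel L nu (delta tie L nu) K S, top_saturated L nu x K
    & ends_at x (gamma tie L nu)].
Proof.
have [l [sel E [I sat]]] := full_runP tie L nu.
pose S := lengths sel.
pose R a := seq_mset (rows (vacancy L (shape nu) a) (S a)).
pose K a := (nu a `\` R a)%mset.
have RE a i t : R a (i, t) = ((t == vacancy L (shape nu) a i) * count_mem (a, i) sel)%N.
  by rewrite /R mset_seqE count_rows count_lengths.
have nuE a : nu a = (K a `+` R a)%mset.
  rewrite /K msetBDK //; apply/msubsetP => -[i t]; rewrite RE.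
  by case: eqP => [->|_]; rewrite ?mul0n ?mul1n ?(inv_count I).
exists (vertex_at sel), K, S; split.
- exact: vertex_at_descent I.
- split=> // a; rewrite {1}/delta E ffunE /=; congr (_ `+` seq_mset _)%mset.
  apply: eq_map => i; congr (_, _); apply: vacancy_perm => b.
  rewrite perm_sym; apply: (@perm_shape _ (K b) (vacancy L.-1 _ b)).
  by rewrite /delta E ffunE.
- move=> a i i0 x1; rewrite /K msetE2 RE eqxx mul1n.
  by apply/eqP; rewrite subn_eq0 sat.
- by exists l => i; apply: vertex_at_last I.
Qed.

(** * The inverse algorithm and uniqueness of greedy chains *)

Lemma walk_rev w x y : walk f_ x w = Some y <-> walk e_ y (rev w) = Some x.
Proof.
elim: w x => [|a w IH] x /=; first by split=> -[->].
rewrite rev_cons walk_rcons; split.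
  by case fx: (f_op _ x) => [z|] //= /IH -> /=; rewrite (f_opK fx).
by case wy: (walk e_ y (rev w)) => [z|] //= ez; rewrite (e_opK ez) /=; apply/IH.
Qed.

(** Climbing lowers the number of the vertex, so a greedy climb terminates. *)
Lemma greedy_up_exists (s : 'I_6 -> nat) x :
  exists n y, greedy e_ (fun a z => - pairing a z) s x n y.
Proof.
have [m] := ubnP (val x); elim: m => // m IH in s x *; rewrite ltnS => xm.
case: (pickP (fun a => (0 < s a)%N && (pairing a x == -1))) => [a|none].
  move=> /andP[sa]; rewrite -e_op_some; case ex: e_op => [z|//] _.
  have zx : (z < m)%N by apply: leq_trans xm; exact: f_op_incr (e_opK ex).
  have [n [y [[w wzy nw] sat]]] := IH (fun c => s c - (c == a))%N z zx.
  exists (fun c => (c == a) + n c)%N, y; split.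
    exists (a :: w) => [|c]; first by rewrite /= ex.
    by rewrite /= nw eq_sym.
  move=> c; have [nc sc] := sat c; split; last move/sc.
    by move: nc; case: eqP => [->|_]; lia.
  by move: nc; case: eqP => [->|_]; lia.
exists (fun=> 0%N), x; split; first by exists [::].
move=> a; split=> // /eqP; rewrite eqr_oppLR => xa.
by have := none a; rewrite xa andbT lt0n => /negbFE/eqP ->.
Qed.

(** Greedy climbs at the lengths N - 1, ..., 0, starting from b. *)
Lemma chain_up_exists (s : nat -> 'I_6 -> nat) b N : exists x (n : nat -> 'I_6 -> nat),
  [/\ forall i, (N <= i)%N -> x i = b, forall i a, (N < i)%N -> n i a = 0%N
    & forall i, (i < N)%N ->
      greedy e_ (fun a z => - pairing a z) (s i) (x i.+1) (n i.+1) (x i)].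
Proof.
elim: N b => [|N IH] b; first by exists (fun=> b), (fun _ _ => 0%N).
have [m [b' G]] := greedy_up_exists (s N) b.
have [x [n [xb n0 Gx]]] := IH b'.
exists (fun i => if (i <= N)%N then x i else b).
exists (fun i => if (i <= N)%N then n i else if i == N.+1 then m else fun=> 0%N).
split=> [i Ni|i a Ni|i].
- by rewrite leqNgt Ni.
- by rewrite leqNgt (ltnW Ni) /= gtn_eqF.
- rewrite ltnS /= => iN; rewrite iN; move: iN.
  rewrite leq_eqVlt => /predU1P[->|iN]; first by rewrite ltnn eqxx xb.
  by rewrite iN; apply: Gx.
Qed.

(** A climb has at most 26 steps, so a supply of 27 rows of each color is as good
    as an infinite one. *)
Lemma climb_reaches_top n x y s : (forall a, 27 <= s a)%N ->
  greedy e_ (fun a z => - pairing a z) s x n y -> y = ord0.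
Proof.
move=> s27 [[w wxy nw] sat]; apply: top_of_no_e => a ya.
have na : n a = s a by apply: (sat a).2; rewrite ya opprK.
have sz : (27 <= size w)%N.
  by apply: leq_trans (s27 a) _; rewrite -na -nw count_size.
suff : (size w + y <= x)%N.
  by move/(leq_trans (leq_addr _ _))/(leq_trans sz); rewrite leqNgt ltn_ord.
elim: w x wxy {nw sz} => [|c w IH] x /=; first by case=> ->.
case ex: e_op => [z|] //= /IH le; apply: leq_ltn_trans le _.
exact: f_op_incr (e_opK ex).
Qed.

(** The inverse algorithm: singular rows of nu' are lengthened along a greedy
    climb from b.  New rows may be created at length 0, which is modelled by the
    supply 27 there.  The riggings of the lengthened rows are prescribed by the
    vacancy numbers that nu will have. *)
Lemma unpeel_exists L nu' b : (0 < L)%N -> exists x K S nu,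
  [/\ descent x S, peel L nu nu' K S, bot_saturated L nu' x K
    & ends_at x b].
Proof.
move=> L0.
pose p' a i := vacancy L.-1 (shape nu') a i.
(* 27 stands for an infinite supply of rows of length 0 *)
pose s i a : nat := if i is 0 then 27%N else singular L.-1 nu' a i.
have [M leM] := bounded_config (shape nu').
have [x [n [xb n0 G]]] := chain_up_exists s b M.+1.
pose S a := flatten [seq nseq (n i a) i | i <- iota 1 M.+1].
have countS a i : count_mem i.+1 (S a) = n i.+1 a.
  rewrite /S count_flatten -map_comp.
  have -> : [seq (count_mem i.+1 \o (fun i0 => nseq (n i0 a) i0)) i0 | i0 <- iota 1 M.+1]
     = [seq ((j == i.+1) * n j a)%N | j <- iota 1 M.+1].
    by apply: eq_map => j /=; rewrite count_nseq.
  rewrite sumnE big_map; case: (ltnP i M.+1) => iM.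
    rewrite (bigD1_seq i.+1) ?iota_uniq ?mem_iota //= eqxx mul1n.
    by rewrite big1 ?addn0 // => j /negPf ->.
  rewrite n0 // big1_seq // => j; rewrite mem_iota => /andP[_ jM].
  by rewrite (_ : j == _ = false) //; lia.
have S0 a : 0%N \notin S a.
  apply/flattenP => -[_ /mapP[j + ->]].
  by rewrite mem_iota mem_nseq => /andP[j0 _] /andP[_ /eqP j00]; rewrite -j00 in j0.
have D : descent x S.
  split=> // [|i]; first by apply: climb_reaches_top (G 0%N isT).
  case: (ltnP i M.+1) => iM.
    have [[w wx nw] _] := G i iM; exists (rev w).
      by apply/walk_rev; rewrite revK.
    by move=> a; rewrite count_rev countS nw.
  exists [::] => [|a]; first by rewrite !xb // leqW.
  by rewrite countS n0.
pose R' a := seq_mset (rows (p' a) (shortened (S a))).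
pose K a := (nu' a `\` R' a)%mset.
have RE a i t : (0 < i)%N -> R' a (i, t) = ((t == p' a i) * n i.+1 a)%N.
  by move=> i0; rewrite /R' mset_seqE count_rows count_shortened // countS.
have sing_far a i : (M < i)%N -> singular L.-1 nu' a i = 0%N.
  move=> Mi; apply/mset_eq0P/negP => /(map_f (fun y => y.1)) /= iin.
  by have := leM a i iin; rewrite leqNgt Mi.
have n_sing a i : (0 < i)%N -> (n i.+1 a <= singular L.-1 nu' a i)%N.
  move=> i0; case: (ltnP i M.+1) => iM; last by rewrite n0.
  by have [_ /(_ a)[]] := G i iM; case: (i) i0.
have nu'E a : nu' a = (K a `+` R' a)%mset.
  rewrite /K msetBDK //; apply/msubsetP => -[[|i] t]; last first.
    by rewrite RE //; case: eqP => [->|_]; rewrite ?mul0n ?mul1n ?n_sing.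
  rewrite mset_seqE count_rows (_ : count_mem _ _ = 0%N) ?muln0 //.
  apply/count_memPn/mapP => -[j]; rewrite mem_filter => /andP[j1 _].
  by case: j j1 => [|[|j]].
pose nu : rigged :=
  [ffun a => (K a `+` seq_mset (rows (fun i => p' a i + pairing a (x i)) (S a)))%mset].
have nuE a : nu a = (K a `+`
  seq_mset (rows (fun i => p' a i + pairing a (x i)) (S a)))%mset by rewrite ffunE.
have pE a i : vacancy L (shape nu) a i = p' a i + pairing a (x i).
  rewrite /p' (vacancy_descent L0 D (fun c => perm_shape (nuE c))
    (fun c => perm_shape (nu'E c)) a i).
  by rewrite subrK.
exists x, K, S, nu; split=> //.
- split=> a; last exact: nu'E.
  by rewrite nuE; congr (_ `+` seq_mset _)%mset; apply: eq_map => i; rewrite pE.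
- move=> a i i0 x1; rewrite /K msetE2 RE // eqxx mul1n -/(singular _ _ _ _).
  case: (ltnP i M.+1) => iM; last by rewrite sing_far.
  have [_ /(_ a)[_]] := G i iM; rewrite x1 opprK => /(_ erefl) ->.
  by case: (i) i0 => // k _; rewrite /= subnn.
- by exists M.+1.
Qed.

Section Uniqueness.
Variables (L : nat) (nu1 nu1' nu2 nu2' : rigged) (x1 x2 : nat -> vertex).
Variables (K1 K2 : 'I_6 -> {mset row_label}%mset) (S1 S2 : 'I_6 -> seq nat).
Hypotheses (L_gt0 : (0 < L)%N) (D1 : descent x1 S1) (D2 : descent x2 S2).
Hypotheses (P1 : peel L nu1 nu1' K1 S1) (P2 : peel L nu2 nu2' K2 S2).

Lemma top_greedy nu nu' x K S i : descent x S -> peel L nu nu' K S ->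
  top_saturated L nu x K ->
  greedy f_ pairing (fun a => singular L nu a i.+1) (x i)
    (fun a => count_mem i.+1 (S a)) (x i.+1).
Proof.
move=> D P sat; split; first exact: descent_walk D i.
move=> a; rewrite /singular (mult_top P) eqxx mul1n leq_addl; split=> // xa.
by rewrite sat.
Qed.

Lemma bot_greedy nu nu' x K S i : descent x S -> peel L nu nu' K S ->
  bot_saturated L nu' x K -> (0 < i)%N ->
  greedy e_ (fun a z => - pairing a z) (fun a => singular L.-1 nu' a i) (x i.+1)
    (fun a => count_mem i.+1 (S a)) (x i).
Proof.
move=> D P sat i0; split.
  have [w wx nw] := descent_walk D i; exists (rev w); first exact/walk_rev.
  by move=> a; rewrite count_rev.
move=> a; rewrite /singular (mult_bot P) // eqxx mul1n leq_addl; split=> // xa.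
by rewrite sat //; apply: oppr_inj; rewrite opprK.
Qed.

(** At the last stage the climb ends at the top vertex, which no arrow enters:
    it is greedy for any sufficient supply. *)
Lemma greedy_to_top x S (s : 'I_6 -> nat) : descent x S ->
  (forall a, count_mem 1%N (S a) <= s a)%N ->
  greedy e_ (fun a z => - pairing a z) s (x 1%N)
    (fun a => count_mem 1%N (S a)) (x 0%N).
Proof.
move=> D le; split.
  have [w wx nw] := descent_walk D 0; exists (rev w); first exact/walk_rev.
  by move=> a; rewrite count_rev.
by move=> a; split=> //; rewrite (descent_start D) pairing_top; case: eqP.
Qed.

Lemma perm_selected : (forall i a, count_mem i.+1 (S1 a) = count_mem i.+1 (S2 a)) ->
  forall a, perm_eq (S1 a) (S2 a).
Proof.
move=> E a; apply/allP => -[|i] _ /=; last by rewrite E.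
by rewrite !(count_memPn _) ?(descent_pos D1) ?(descent_pos D2).
Qed.

Lemma top_unique : nu1 = nu2 -> top_saturated L nu1 x1 K1 ->
  top_saturated L nu2 x2 K2 -> x1 =1 x2 /\ nu1' = nu2'.
Proof.
move=> E sat1 sat2.
have step i : x1 i = x2 i ->
    (forall a, count_mem i.+1 (S1 a) = count_mem i.+1 (S2 a)) /\ x1 i.+1 = x2 i.+1.
  move=> xi; have G1 := top_greedy i D1 P1 sat1; have G2 := top_greedy i D2 P2 sat2.
  by rewrite -xi -E in G2; have [] := greedy_unique down_minuscule G1 G2.
have x12 i : x1 i = x2 i.
  elim: i => [|i /step[]//]; by rewrite (descent_start D1) (descent_start D2).
have S12 := perm_selected (fun i => (step i (x12 i)).1).
split=> //; apply/ffunP => a.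
have KE : K1 a = K2 a.
  apply/msetP => -[i t]; have := mult_top P1 a i t; rewrite E (mult_top P2).
  by rewrite (permP (S12 a)) => /addIn.
rewrite (peel_bot P1) (peel_bot P2) KE; congr (_ `+` _)%mset.
apply/eq_seq_msetP.
have -> : rows (vacancy L.-1 (shape nu1') a) (shortened (S1 a))
     = rows (vacancy L.-1 (shape nu2') a) (shortened (S1 a)).
  apply: eq_map => i; rewrite (vacancy_peel L_gt0 D1 P1) (vacancy_peel L_gt0 D2 P2).
  by rewrite E x12.
by apply/perm_map/perm_map/perm_filter.
Qed.

Lemma bot_unique : nu1' = nu2' -> bot_saturated L nu1' x1 K1 ->
  bot_saturated L nu2' x2 K2 ->
  (exists N, forall i, (N <= i)%N -> x1 i = x2 i) -> nu1 = nu2.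
Proof.
move=> E sat1 sat2 [N far].
have step i : (0 < i)%N -> x1 i.+1 = x2 i.+1 ->
    (forall a, count_mem i.+1 (S1 a) = count_mem i.+1 (S2 a)) /\ x1 i = x2 i.
  move=> i0 xi; have G1 := bot_greedy D1 P1 sat1 i0.
  have G2 := bot_greedy D2 P2 sat2 i0.
  by rewrite -xi -E in G2; apply: greedy_unique up_minuscule _ _ _ _ _ _ G1 G2.
have x12 i : (0 < i)%N -> x1 i = x2 i.
  move=> i0; have [k] := ubnP (N - i); elim: k => // k IH in i i0 *.
  move=> lek; case: (leqP N i) => [/far//|iN].
  by apply: (proj2 (step i i0 (IH i.+1 _ _))) => //; lia.
have x0 : x1 0%N = x2 0%N by rewrite (descent_start D1) (descent_start D2).
(* at length 0 the common top vertex replaces the greedy condition *)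
have S12 : forall a, perm_eq (S1 a) (S2 a).
  apply: perm_selected => -[|i] a; last by have [] := step i.+1 isT (x12 i.+2 isT).
  pose s c := (count_mem 1%N (S1 c) + count_mem 1%N (S2 c))%N.
  have G1 : greedy e_ (fun c z => - pairing c z) s (x1 1%N)
      (fun c => count_mem 1%N (S1 c)) (x1 0%N).
    by apply: greedy_to_top => // c; rewrite leq_addr.
  have G2 : greedy e_ (fun c z => - pairing c z) s (x2 1%N)
      (fun c => count_mem 1%N (S2 c)) (x2 0%N).
    by apply: greedy_to_top => // c; rewrite leq_addl.
  by rewrite -x12 // in G2; have [-> ] := greedy_unique up_minuscule G1 G2.
apply/ffunP => a.
have KE : K1 a = K2 a.
  have E' : rows (vacancy L.-1 (shape nu1') a) (shortened (S1 a))
       = rows (vacancy L.-1 (shape nu2') a) (shortened (S1 a)) by rewrite E.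
  have perm : perm_eq (shortened (S1 a)) (shortened (S2 a)).
    exact/perm_map/perm_filter.
  have := peel_bot P1 a; rewrite E' E (peel_bot P2 a).
  rewrite (eq_seq_msetP _ _ (perm_map _ perm)).
  by move/(can_inj (msetDKBC _)).
rewrite (peel_top P1) (peel_top P2) KE; congr (_ `+` _)%mset.
apply/eq_seq_msetP.
have -> : rows (vacancy L (shape nu1) a) (S1 a) = rows (vacancy L (shape nu2) a) (S1 a).
  apply: eq_map => i; congr (_, _).
  have := vacancy_peel L_gt0 D1 P1 a i; have := vacancy_peel L_gt0 D2 P2 a i.
  have -> : x1 i = x2 i by case: i => [|i]; rewrite ?x0 ?x12.
  by rewrite E => -> /addIr.
exact/perm_map.
Qed.

End Uniqueness.

(** * Bijection with paths *)

Lemma delta_RC tie L lam nu : (0 < L)%N -> RC lam L nu ->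
  dominant (lam - wt (gamma tie L nu)) /\
  RC (lam - wt (gamma tie L nu)) L.-1 (delta tie L nu).
Proof.
move=> L0 R; have [x [K [S [D P sat far]]]] := delta_spec tie L nu.
exact: RC_peel L0 D P _ _ R sat far.
Qed.

Lemma ends_at_far (x y : nat -> vertex) b : ends_at x b -> ends_at y b ->
  exists N, forall i, (N <= i)%N -> x i = y i.
Proof.
move=> [N xb] [M yb]; exists (maxn N M) => i.
by rewrite geq_max => /andP[/xb -> /yb ->].
Qed.

Lemma ends_at_ext (x y : nat -> vertex) b c : ends_at x b -> ends_at y c ->
  x =1 y -> b = c.
Proof.
move=> [N xb] [M yc] xy.
by rewrite -(xb (maxn N M)) ?leq_maxl // xy yc // leq_maxr.
Qed.

Lemma delta_tie tie tie' L nu : (0 < L)%N ->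
  gamma tie L nu = gamma tie' L nu /\ delta tie L nu = delta tie' L nu.
Proof.
move=> L0; have [x [K [S [D P sat far]]]] := delta_spec tie L nu.
have [x' [K' [S' [D' P' sat' far']]]] := delta_spec tie' L nu.
have [xx ->] := top_unique L0 D D' P P' erefl sat sat'.
by split=> //; apply: ends_at_ext far far' xx.
Qed.

Lemma delta_inj tie tie' L lam lam' nu nu' : (0 < L)%N ->
  RC lam L nu -> RC lam' L nu' -> gamma tie L nu = gamma tie' L nu' ->
  delta tie L nu = delta tie' L nu' -> nu = nu'.
Proof.
move=> L0 R R' Eg Ed; have [x [K [S [D P _ far]]]] := delta_spec tie L nu.
have [x' [K' [S' [D' P' _ far']]]] := delta_spec tie' L nu'.
apply: (bot_unique L0 D D' P P' Ed (RC_bot_saturated L0 D P R)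
  (RC_bot_saturated L0 D' P' R')).
by rewrite Eg in far; apply: ends_at_far far far'.
Qed.

Lemma delta_surj tie L lam nu' b : (0 < L)%N -> RC lam L.-1 nu' ->
  dominant (lam + wt b) -> exists nu,
  [/\ RC (lam + wt b) L nu, delta tie L nu = nu' & gamma tie L nu = b].
Proof.
move=> L0 R dom; have [x [K [S [nu [D P sat far]]]]] := unpeel_exists nu' b L0.
have [x' [K' [S' [D' P' sat' far']]]] := delta_spec tie L nu.
have [xx E] := top_unique L0 D D' P P' erefl (RC_top_saturated L0 D P R) sat'.
exists nu; split=> //; first exact: RC_unpeel L0 D P _ _ R sat far dom.
by apply/esym; apply: ends_at_ext far far' xx.
Qed.

(** A statistic E that drops by one under g, and vanishes exactly where g is
    undefined, is the depth. *)
Lemma depthE (T : finType) (g : T -> option T) (E : T -> nat) x :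
  (forall y, if g y is Some z then E y = (E z).+1 else E y = 0%N) ->
  (forall y, E y < #|T|)%N -> depth g x = E x.
Proof.
move=> step bound; have iterE k y : iter k (obind g) (Some y) = (k <= E y)%N :> bool.
  elim: k y => // k IH y; rewrite iterSr /=; have := step y.
  case: (g y) => [z -> |->]; first by rewrite IH.
  by have -> : iter k (obind g) None = None by elim: (k) => //= j ->.
apply/eqP; rewrite eqn_leq; apply/andP; split.
  by apply/bigmax_leqP => k; rewrite iterE.
by apply: (@leq_bigmax_cond _ _ (fun k : 'I__ => val k) (Ordinal (bound x))); rewrite iterE /=.
Qed.

Lemma phi_pairing a x : phi (node a) x = (pairing a x == 1).
Proof. by rewrite phiE -f_op_has f_op_some. Qed.

(** The number of times the raising operator of color a applies to a word: the
    signature rule when all strings have length at most one. *)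
Fixpoint defect (a : 'I_6) (s : seq vertex) : nat :=
  if s is x :: s' then
    ((pairing a x == -1%R) + (defect a s' - (pairing a x == 1%R)))%N
  else 0%N.

Lemma defect_size a s : (defect a s <= size s)%N.
Proof.
elim: s => //= x s IH; case: eqP => _; last by rewrite add0n; lia.
by rewrite add1n ltnS; lia.
Qed.

Lemma e_tuple_defect a n (b : n.-tuple vertex) :
  if e_tuple (node a) b is Some c then defect a b = (defect a c).+1
  else defect a b = 0%N.
Proof.
elim: n b => [|n IH] b; first by rewrite tuple0.
case/tupleP: b => x s.
have depthD : depth (@e_tuple (node a) n) s = defect a s.
  apply: (depthE (E := fun c : n.-tuple vertex => defect a c)) => // c.
  rewrite card_tuple card_ord; apply: leq_ltn_trans (defect_size _ _) _.
  by rewrite size_tuple ltn_expl.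
rewrite /= /tensor_e theadE.
have -> : behead_tuple (cons_tuple x s) = s by apply/val_inj.
rewrite /= depthD -/(phi _ _) phi_pairing; case: leqP => le.
  case ex: e_op => [c|] /=.
    have x1 : pairing a x = -1 by apply/eqP; rewrite -e_op_some ex.
    have := f_op_pairing (e_opK ex) a; rewrite cartan_diag x1 => c1.
    have {c1} -> : pairing a c = 1 by lia.
    by move: le; rewrite x1 /=; lia.
  have -> : (pairing a x == -1) = false by rewrite -e_op_some ex.
  by move: le; lia.
have := IH s; case: e_tuple => [c|] /= E; last by move: le; rewrite E.
by move: le; rewrite E; lia.
Qed.

(** The bound defect a s <= k says that k plus any partial sum of the pairings
    is nonnegative; the last letter adds one more partial sum. *)
Lemma defect_rcons a s x k : (defect a (rcons s x) <= k)%N =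
  (defect a s <= k)%N && (0 <= k%:Z + \sum_(y <- s) pairing a y + pairing a x).
Proof.
elim: s k => [|y s IH] k /=.
  rewrite big_nil addr0; have /andP[] := pairing_range a x.
  by case: eqP; lia.
rewrite big_cons; have /andP[] := pairing_range a y.
have [y1|y1] := eqVneq (pairing a y) 1.
  by rewrite y1 /= => _ _; rewrite !add0n !leq_subLR IH addrA; congr (_ && (_ <= _ + _ + _)); lia.
have [y2|y2] := eqVneq (pairing a y) (-1).
  rewrite y2 /= => _ _; case: k => [|k]; first by rewrite !add1n.
  by rewrite !subn0 !add1n !ltnS IH; congr (_ && (_ <= _ )); rewrite intS; ring.
move=> ? ?; have -> : pairing a y = 0 by lia.
by rewrite !add0n !subn0 IH add0r.
Qed.

Lemma e_tuple_None a n (b : n.-tuple vertex) :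
  e_tuple (node a) b = None <-> defect a b = 0%N.
Proof. by have := e_tuple_defect a b; case: e_tuple => [c ->|->]. Qed.

Lemma wt_tuple_pairing n (b : n.-tuple vertex) a :
  wt_tuple b 0 a = \sum_(y <- b) pairing a y.
Proof. by rewrite /wt_tuple summxE. Qed.

(** By induction, paths are the words all of whose prefixes have dominant
    weight. *)
Lemma paths_rcons lam L (b : L.-tuple vertex) x :
  paths lam L.+1 (rcons_tuple b x) <-> paths (lam - wt x) L b /\ dominant lam.
Proof.
have wtE : wt_tuple (rcons_tuple b x) = wt_tuple b + wt x.
  by rewrite /wt_tuple /= -cats1 big_cat big_seq1.
have defE a : wt_tuple (rcons_tuple b x) = lam ->
  (e_tuple (node a) (rcons_tuple b x) = None <->
  e_tuple (node a) b = None /\ 0 <= lam 0 a).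
  move=> <-; rewrite !e_tuple_None wtE weightD wt_tuple_pairing /=.
  have := defect_rcons a b x 0; rewrite !leqn0 add0r => E.
  by split=> [/eqP|[/eqP d0 le]]; [rewrite E => /andP[/eqP]|apply/eqP; rewrite E d0].
split=> [[wtb high]|[[wtb high] dom]].
  split; last by move=> a; have /(defE a wtb)[] := high a.
  split; first by rewrite -wtb wtE addrK.
  by move=> a; have /(defE a wtb)[] := high a.
have wt' : wt_tuple (rcons_tuple b x) = lam by rewrite wtE wtb subrK.
by split=> // a; apply/(defE a wt'); split; [apply: high|apply: dom].
Qed.

(** The coordinates of the sum of the positive coroots, which pairs with every
    simple root to 2: they turn dominance into a bound on the number of boxes. *)
Definition two_rho (a : nat) : int := nth 0 [:: 16; 30; 42; 30; 16; 22] a.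

Lemma rho_cartan b : \sum_(a < 6) two_rho a * C a b = 2.
Proof.
by case: b => -[|[|[|[|[|[|//]]]]]] ?; rewrite !big_ord_recl big_ord0.
Qed.

(** For L = 0 the weight is minus a sum of simple roots, so pairing it with
    two_rho gives minus twice the number of boxes. *)
Lemma RC0_empty lam nu : dominant lam -> RC lam 0 nu ->
  nu = [ffun=> mset0] /\ lam = 0.
Proof.
move=> dom [pos [/weight_vacancy [N vE] _] _].
pose Q b := (\sum_(j <- shape nu b) minn N.+1 j)%N.
have lamE a : lam 0 a = - \sum_b C a b * (Q b)%:Z.
  by rewrite -(vE N.+1) // /vacancy mul0n sub0r.
have sumE : \sum_(a < 6) two_rho a * lam 0 a = - (\sum_b 2 * (Q b)%:Z).
  under eq_bigr => a _ do rewrite lamE mulrN mulr_sumr.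
  rewrite sumrN exchange_big /=; congr (- _); apply: eq_bigr => b _.
  by rewrite -(rho_cartan b) mulr_suml; apply: eq_bigr => a _; rewrite mulrA.
have Q0 b : Q b = 0%N.
  have ge : 0 <= \sum_(a < 6) two_rho a * lam 0 a.
    apply: sumr_ge0 => a _; apply: mulr_ge0; last exact: dom.
    by case: a => -[|[|[|[|[|[|//]]]]]].
  have le : 2 * (Q b)%:Z <= \sum_b 2 * (Q b)%:Z.
    by rewrite (bigD1 b) //= lerDl; apply: sumr_ge0 => c _; rewrite mulr_ge0.
  by rewrite sumE in ge; lia.
have nu0 b : nu b = mset0.
  apply/eqP; rewrite -msubset0; apply/msubsetP => y; rewrite mset0E leqn0 mset_eq0.
  apply/negP => yb; have := pos b y yb.
  have := Q0 b; rewrite /Q (big_rem y.1) ?map_f //= => /eqP.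
  by rewrite addn_eq0 => /andP[]; lia.
split; first by apply/ffunP => b; rewrite ffunE nu0.
apply/rowP => a; rewrite lamE mxE big1 ?oppr0 // => b _.
by rewrite Q0 mulr0.
Qed.

Lemma RC0_nil : RC 0 0 [ffun=> mset0].
Proof.
have E a : shape [ffun=> mset0] a = [::] by rewrite /shape ffunE enum_mset0.
split=> [a y|/=|a y]; try by rewrite ffunE in_mset0.
have v0 a i : vacancy 0 (shape [ffun=> mset0]) a i = 0.
  by rewrite /vacancy mul0n big1 ?subr0 // => b _; rewrite E big_nil mulr0.
split=> [|a i _]; last by rewrite v0.
by apply/weight_vacancy; exists 0%N => i a _; rewrite v0 mxE.
Qed.

Lemma rcons_tuple_onto (T : Type) n (t : n.+1.-tuple T) :
  exists (b : n.-tuple T) x, t = rcons_tuple b x.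
Proof.
case: t => s; case/lastP: s => // s x sz.
have szs : size s == n by rewrite -eqSS -(size_rcons s x).
by exists (Tuple szs), x; apply/val_inj.
Qed.

Lemma paths_dominant lam L b : paths lam L b -> dominant lam.
Proof.
case: L b => [|L] b; last by have [c [x ->]] := rcons_tuple_onto b => /paths_rcons[].
by move=> [<- _] a; rewrite wt_tuple_pairing tuple0 big_nil.
Qed.

Lemma Phi_bij tie L lam : dominant lam -> set_bij (RC lam L) (paths lam L) (Phi tie L).
Proof.
elim: L lam => [|L IH] lam dom.
  split.
  - move=> nu /(RC0_empty dom)[_ ->]; split=> //=.
    by rewrite /wt_tuple big_nil.
  - by move=> nu nu' /set_mem/(RC0_empty dom)[-> _] /set_mem/(RC0_empty dom)[-> _].
  - move=> b [wtb _]; have lam0 : lam = 0 by rewrite -wtb tuple0 /wt_tuple big_nil.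
    by exists [ffun=> mset0]; [rewrite lam0; apply: RC0_nil|rewrite [RHS]tuple0].
split.
- move=> nu R; have [dom' R'] := delta_RC tie (ltn0Sn L) R.
  have [fun_ _ _] := IH _ dom'.
  by apply/paths_rcons; split=> //; apply: fun_.
- move=> nu nu' /set_mem R /set_mem R' EPhi.
  have E : rcons (Phi tie L (delta tie L.+1 nu)) (gamma tie L.+1 nu)
    = rcons (Phi tie L (delta tie L.+1 nu')) (gamma tie L.+1 nu') :> seq vertex.
    exact: (congr1 (@tval L.+1 vertex) EPhi).
  have EP : Phi tie L (delta tie L.+1 nu) = Phi tie L (delta tie L.+1 nu').
    exact: val_inj (congr1 fst (rcons_inj E)).
  have Eg : gamma tie L.+1 nu = gamma tie L.+1 nu' := congr1 snd (rcons_inj E).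
  have [dom1 R1] := delta_RC tie (ltn0Sn L) R.
  have [_ R1'] := delta_RC tie (ltn0Sn L) R'; rewrite -Eg in R1'.
  have [_ inj _] := IH _ dom1.
  have Ed : delta tie L.+1 nu = delta tie L.+1 nu'.
    exact: (inj _ _ (mem_set R1) (mem_set R1') EP).
  exact: delta_inj (ltn0Sn L) R R' Eg Ed.
- move=> t; have [b [x ->]] := rcons_tuple_onto t => /paths_rcons[pb _].
  have dom' : dominant (lam - wt x).
    exact: paths_dominant pb.
  have [_ _ /(_ b pb)[nu' R' Eb]] := IH _ dom'.
  have [||nu [R Ed Eg]] := @delta_surj tie L.+1 (lam - wt x) nu' x _ R' => //.
    by rewrite subrK.
  exists nu; first by rewrite subrK in R.
  by apply/val_inj; rewrite /= Ed Eg Eb.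
Qed.

(** * The energy function *)

(** Two energy functions obey the same recursion, so their difference is constant
    on the connected components of the crystal graph of the tensor square. *)
Definition energy_gap (H : vertex -> vertex -> int) b b' := H b b' - energy b b'.

Lemma energy_gap_const H i b b' c c' : is_energy H ->
  tensor_e (f_op i) (e_op i) (e_op i) (b, b') = Some (c, c') ->
  energy_gap H c c' = energy_gap H b b'.
Proof.
move=> [_ H0l H0r Hi] E; have [_ E0l E0r Ei] := energyP; rewrite /energy_gap.
have [i0|i0] := eqVneq i ord0; last by rewrite (Hi _ _ _ _ _ i0 E) (Ei _ _ _ _ _ i0 E).
rewrite {}i0 in E; have := E; rewrite {1}/tensor_e /=.
case: ifP => _.
  case e_b: e_op => [d|//] [dc b'c']; rewrite dc in e_b; rewrite -b'c' in E *.
  by rewrite (H0l _ _ _ E e_b) (E0l _ _ _ E e_b); ring.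
case e_b: e_op => [d|//] [bc dc']; rewrite dc' in e_b; rewrite -bc in E *.
by rewrite (H0r _ _ _ E e_b) (E0r _ _ _ E e_b); ring.
Qed.

Lemma energy_gap_left H i x y (z : vertex) : is_energy H -> arrow i x y ->
  (has_in i z.+1 <= has_out i y.+1)%N -> energy_gap H x z = energy_gap H y z.
Proof.
move=> HH; rewrite -e_opE => /eqP ey le; apply: (energy_gap_const (i := i)) => //.
by rewrite /tensor_e /= -/(epsilon i z) -/(phi i y) epsilonE phiE le ey.
Qed.

Lemma energy_gap_right H i x y (z : vertex) : is_energy H -> arrow i x y ->
  ~~ (has_in i y.+1 <= has_out i z.+1)%N -> energy_gap H z x = energy_gap H z y.
Proof.
move=> HH; rewrite -e_opE => /eqP ey /negbTE le; apply: (energy_gap_const (i := i)) => //.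
by rewrite /tensor_e /= -/(epsilon i y) -/(phi i z) epsilonE phiE le ey.
Qed.

(** A certificate of connectedness, with vertices counted from 0: each pair other
    than (0, 0) is joined by one arrow to a pair of smaller rank.  Classical arrows lead to pairs with u = 0;
    among these, v rises to 16 or to 26, from where the arrow of color 0 leads
    to (0, 0) or to (0, 5). *)
Definition pair_rank (u v : nat) : nat :=
  if u == 0%N then if v == 0%N then 0%N else if (v < 17)%N then (17 - v)%N else (44 - v)%N
  else (28 + u + v)%N.

(** The arrow t acts on one factor of the pair, in either direction.  The nested
    conditionals keep the evaluation from testing the arrows of color i when the
    endpoints already disagree. *)
Definition linked_by (u v : nat) (t : nat * nat * nat) (u' v' : nat) : bool :=
  let: (i, x, y) := t in
  [|| if [&& u == y.-1, u' == x.-1 & v == v']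
      then (has_in i v.+1 <= has_out i y)%N else false,
      if [&& u == x.-1, u' == y.-1 & v == v']
      then (has_in i v.+1 <= has_out i y)%N else false,
      if [&& v == y.-1, v' == x.-1 & u == u']
      then ~~ (has_in i y <= has_out i u.+1)%N else false
    | if [&& v == x.-1, v' == y.-1 & u == u']
      then ~~ (has_in i y <= has_out i u.+1)%N else false].

Lemma linked_energy_gap H (u v u' v' : vertex) t : is_energy H -> t \in arrows ->
  linked_by u v t u' v' -> energy_gap H u v = energy_gap H u' v'.
Proof.
move=> HH; case: t => [[i x] y] tin.
have /and5P[/= i7 x0 x28 y0 y28] := arrows_bound tin.
pose i' : 'I_7 := Ordinal i7.
have arr (z w : vertex) : val z = x.-1 -> val w = y.-1 -> arrow i' z w.
  by rewrite /arrow /= => -> ->; rewrite !prednK.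
rewrite -(prednK y0) -(prednK x0) /=.
case/or4P; case: and3P => // -[/eqP e1 /eqP e2 /eqP /val_inj e3].
- rewrite -e1 -e3 => le; apply/esym/(energy_gap_left (i := i')) => //.
  exact: arr.
- rewrite -e2 -e3 => le; apply: (energy_gap_left (i := i')) => //.
  exact: arr.
- rewrite -e1 -e3 => le; apply/esym/(energy_gap_right (i := i')) => //.
  exact: arr.
- rewrite -e2 -e3 => le; apply: (energy_gap_right (i := i')) => //.
  exact: arr.
Qed.

Lemma linked_check :
  all (fun u => all (fun v => (u == 0)%N && (v == 0)%N || has (fun t =>
    let: (i, x, y) := t in
    has (fun p => (pair_rank p.1 p.2 < pair_rank u v)%N && linked_by u v t p.1 p.2)
      [:: (x.-1, v); (y.-1, v); (u, x.-1); (u, y.-1)]) arrows)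
    (iota 0 27)) (iota 0 27) = true.
Proof. by vm_compute. Qed.

Lemma energy_unique H : is_energy H -> H =2 energy.
Proof.
move=> HH.
suff H0 u v : energy_gap H u v = 0.
  by move=> u v; apply/eqP; rewrite -subr_eq0 -/(energy_gap _ _ _) H0.
have [m] := ubnP (pair_rank u v); elim: m => // m IH in u v *; rewrite ltnS => uvm.
have := all_iota0 (all_iota0 linked_check u) v => /orP[/andP[/eqP u0 /eqP v0]|].
  have -> : u = ord0 by apply: val_inj.
  have -> : v = ord0 by apply: val_inj.
  rewrite /energy_gap.
  by have [-> _ _ _] := HH; have [-> _ _ _] := energyP; rewrite subrr.
case/hasP=> -[[i x] y] tin; have /and5P[/= i7 x0 x28 y0 y28] := arrows_bound tin.
move=> step; have /hasP[[u' v'] pin /andP[/= lt lnk]] : has (fun p =>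
    (pair_rank p.1 p.2 < pair_rank u v)%N && linked_by u v (i, x, y) p.1 p.2)
  [:: (x.-1, val v); (y.-1, val v); (val u, x.-1); (val u, y.-1)] := step.
have x27 : (x.-1 < 27)%N by rewrite -ltnS prednK.
have y27 : (y.-1 < 27)%N by rewrite -ltnS prednK.
have [u27 v27] : (u' < 27)%N /\ (v' < 27)%N.
  by move: pin; rewrite !inE => /or4P[] /eqP[-> ->].
rewrite (linked_energy_gap (u' := Ordinal u27) (v' := Ordinal v27) HH tin lnk).
by apply: IH; apply: leq_trans uvm.
Qed.

(** Row x lists the coordinates of wt 1 - wt x with respect to the simple roots,
    i.e. the number of arrows of each color on any way from the top to x. *)
Definition content_table : seq (seq nat) :=
  [:: [:: 0; 0; 0; 0; 0; 0]; [:: 1; 0; 0; 0; 0; 0]; [:: 1; 1; 0; 0; 0; 0];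
      [:: 1; 1; 1; 0; 0; 0]; [:: 1; 1; 1; 1; 0; 0]; [:: 1; 1; 1; 1; 1; 0];
      [:: 1; 1; 1; 0; 0; 1]; [:: 1; 1; 1; 1; 0; 1]; [:: 1; 1; 1; 1; 1; 1];
      [:: 1; 1; 2; 1; 0; 1]; [:: 1; 1; 2; 1; 1; 1]; [:: 1; 1; 2; 2; 1; 1];
      [:: 1; 2; 2; 1; 0; 1]; [:: 1; 2; 2; 1; 1; 1]; [:: 1; 2; 2; 2; 1; 1];
      [:: 1; 2; 3; 2; 1; 1]; [:: 1; 2; 3; 2; 1; 2]; [:: 2; 2; 2; 1; 0; 1];
      [:: 2; 2; 2; 1; 1; 1]; [:: 2; 2; 2; 2; 1; 1]; [:: 2; 2; 3; 2; 1; 1];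
      [:: 2; 2; 3; 2; 1; 2]; [:: 2; 3; 3; 2; 1; 1]; [:: 2; 3; 3; 2; 1; 2];
      [:: 2; 3; 4; 2; 1; 2]; [:: 2; 3; 4; 3; 1; 2]; [:: 2; 3; 4; 3; 2; 2]]%N.

Definition content (a x : nat) : nat := nth 0%N (nth [::] content_table x) a.

Lemma content_check :
  all (fun t => (t.1.1 == 0)%N || all (fun b =>
    content b t.2.-1 == (t.1.1 == b.+1) + content b t.1.2.-1)%N (iota 0 6)) arrows.
Proof. by vm_compute. Qed.

Lemma content_top (a : 'I_6) : content a 0 = 0%N.
Proof. by case: a => -[|[|[|[|[|[|]]]]]]. Qed.

Lemma walk_content w x y (a : 'I_6) : walk f_ x w = Some y ->
  content a y = (count_mem a w + content a x)%N.
Proof.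
elim: w x => [|c w IH] x /=; first by case=> ->.
case fx: f_op => [z|] //= /IH ->.
have /all_iota0 /(_ a) /eqP /= -> := allP content_check _ (f_opP fx).
rewrite addnCA addnA; congr (_ + _ + _)%N.
Qed.

Lemma energy_top_check : all (fun y => table_entry 0 y == content 0 y) (iota 0 27).
Proof. by vm_compute. Qed.

Lemma energy_top x : energy ord0 x = - (content 0 x)%:Z.
Proof. by rewrite /energy -/(table_entry _ _) (eqP (all_iota0 energy_top_check x)). Qed.

(** The data of an interval on which the hypotheses of local_rule depend. *)
Definition interval_data (x y : nat) : nat * nat * (seq nat * (seq nat * seq nat)) :=
  (x, y, ([seq (content a y - content a x)%N | a <- iota 0 6],
    ([seq a <- iota 0 6 | has_in a.+1 x.+1], [seq a <- iota 0 6 | has_out a.+1 y.+1]))).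

Definition below (x y : nat) : bool := all (fun a => content a x <= content a y)%N (iota 0 6).

(** The intervals are computed once, as each is compared with all others. *)
Definition intervals := Eval vm_compute in
  [seq interval_data p.1 p.2
    | p <- [seq (x, y) | x <- iota 0 27, y <- iota 0 27] & below p.1 p.2].

Definition locally_constant (p q : nat * nat * (seq nat * (seq nat * seq nat))) : bool :=
  let: (v, v', (n, (into_v, _))) := p in
  let: (u, u', (k, (_, out_u'))) := q in
  if all (fun a => nth 0 k a <= nth 0 n a)%N into_v then
    if all (fun a => nth 0 n a <= nth 0 k a)%N out_u'
    then table_entry u v == table_entry u' v' else true
  else true.

Lemma local_rule_check : all (fun p => all (locally_constant p) intervals) intervals.
Proof. by vm_compute. Qed.

Lemma mem_intervals (x y : vertex) : (forall a : 'I_6, content a x <= content a y)%N ->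
  interval_data x y \in intervals.
Proof.
move=> xy; have -> : intervals = [seq interval_data p.1 p.2
    | p <- [seq (x, y) | x <- iota 0 27, y <- iota 0 27] & below p.1 p.2].
  by vm_compute.
apply/mapP; exists (val x, val y) => //; rewrite mem_filter; apply/andP; split.
  by apply/allP => a; rewrite mem_iota => /= a6; apply: (xy (Ordinal a6)).
by apply/allpairsP; exists (val x, val y); split; rewrite ?mem_iota ?ltn_ord.
Qed.

Lemma nth_content_diff (x y : nat) (a : 'I_6) :
  nth 0%N [seq (content b y - content b x)%N | b <- iota 0 6] a
  = (content a y - content a x)%N.
Proof. by rewrite (nth_map 0%N) ?size_iota // nth_iota. Qed.

(** One length of two successive runs preserves the energy: v descends to v' in
    the first run, and u to u' in the second.  As the numbers of arrows depend
    on the endpoints only, this is a finite statement about pairs of intervals,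
    and it holds for all of them. *)
Lemma local_rule (u u' v v' : vertex) (w w' : seq 'I_6) :
  walk f_ v w = Some v' -> walk f_ u w' = Some u' ->
  (forall a, pairing a v = -1 -> (count_mem a w' <= count_mem a w)%N) ->
  (forall a, pairing a u' = 1 -> (count_mem a w <= count_mem a w')%N) ->
  energy u v = energy u' v'.
Proof.
move=> vv uu le_v le_u; rewrite /energy -!/(table_entry _ _); congr (- _%:Z).
have mem (x y : vertex) s : walk f_ x s = Some y -> interval_data x y \in intervals.
  by move=> xy; apply: mem_intervals => a; rewrite (walk_content a xy) leq_addl.
have /allP/(_ _ (mem _ _ _ uu)) := allP local_rule_check _ (mem _ _ _ vv).
rewrite /locally_constant /interval_data.
have -> : all (fun a => nth 0 [seq (content b u' - content b u)%N | b <- iota 0 6] a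
    <= nth 0 [seq (content b v' - content b v)%N | b <- iota 0 6] a)%N
    [seq a <- iota 0 6 | has_in a.+1 v.+1].
  apply/allP => a; rewrite mem_filter mem_iota => /andP[ina /= a6].
  rewrite !(nth_content_diff _ _ (Ordinal a6)).
  rewrite (walk_content (Ordinal a6) vv) (walk_content (Ordinal a6) uu) !addnK.
  by apply: le_v; apply/eqP; rewrite -e_op_some e_op_has.
have -> : all (fun a => nth 0 [seq (content b v' - content b v)%N | b <- iota 0 6] a
    <= nth 0 [seq (content b u' - content b u)%N | b <- iota 0 6] a)%N
    [seq a <- iota 0 6 | has_out a.+1 u'.+1].
  apply/allP => a; rewrite mem_filter mem_iota => /andP[outa /= a6].
  rewrite !(nth_content_diff _ _ (Ordinal a6)).
  rewrite (walk_content (Ordinal a6) vv) (walk_content (Ordinal a6) uu) !addnK.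
  by apply: le_u; apply/eqP; rewrite -f_op_some f_op_has.
by move/eqP.
Qed.

(** * Variation of the charge *)

Lemma sum_shortened (F : nat -> int) s : 0%N \notin s ->
  \sum_(j <- s) F j.-1 = \sum_(j <- shortened s) F j + F 0%N *+ count_mem 1%N s.
Proof.
elim: s => [|j s IH]; first by rewrite !big_nil addr0.
rewrite inE negb_or eq_sym -lt0n => /andP[j0 /IH {}IH].
rewrite big_cons IH /shortened /=; case: j j0 => [//|[|j]] _ /=.
  by rewrite mulrS; ring.
by rewrite big_cons add0n; ring.
Qed.

Lemma sum_by_level (F : nat -> int) s N : (forall j, j \in s -> (0 < j <= N)%N) ->
  \sum_(j <- s) F j = \sum_(i < N) F i.+1 *+ count_mem i.+1 s.
Proof.
elim: s => [|j s IH] le; first by rewrite big_nil big1.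
rewrite big_cons IH => [|k ks]; last by apply: le; rewrite inE ks orbT.
have /andP[j0 jN] := le j (mem_head _ _); case: j j0 jN {le} => // j _ jN.
rewrite [in RHS](bigD1 (Ordinal jN)) //= eqxx mulrS.
rewrite [in LHS](bigD1 (Ordinal jN)) //= addrA; congr (_ + _).
apply: eq_bigr => k; rewrite -(inj_eq val_inj) /= eqSS eq_sym => /negPf ->.
by [].
Qed.

Lemma sum_word (F : 'I_6 -> int) w : \sum_a F a *+ count_mem a w = \sum_(a <- w) F a.
Proof.
elim: w => [|c w IH]; first by rewrite big_nil big1.
rewrite big_cons -IH; under eq_bigr => a _ do rewrite /= mulrnDr.
rewrite big_split /= (bigD1 c) //= eqxx mulr1n big1 ?addr0 // => a.
by rewrite eq_sym => /negPf ->.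
Qed.

(** At each length the sum is the one of walk_norm, and so vanishes. *)
Lemma descent_norm x S : descent x S ->
  \sum_a \sum_(i <- S a) (pairing a (x i) + pairing a (x i.-1)) = 0.
Proof.
move=> D; have [N leN] := bounded_config S.
have lv a j : j \in S a -> (0 < j <= N)%N.
  by case: j => [|j /leN //]; rewrite (negPf (descent_pos D a)).
under eq_bigr => a _ do rewrite (sum_by_level _ (lv a)).
rewrite exchange_big big1 //= => i _.
have [w wx nw] := descent_walk D i.
under eq_bigr => a _ do rewrite -nw addrC.
by rewrite sum_word; apply: (walk_norm down_minuscule).
Qed.

Definition vacancy_sum L (nu : config) : int :=
  \sum_a \sum_(j <- nu a) vacancy L nu a j.

Lemma charge_config_vacancy L (nu : config) :
  2 * charge_config L nu = - ((L * size (nu ord0))%N%:Z + vacancy_sum L nu)%:~R.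
Proof.
rewrite /charge_config.
have E : \sum_a \sum_b \sum_(j <- nu a) \sum_(k <- nu b) C a b * (minn j k)%:Z
  = (L * size (nu ord0))%N%:Z - vacancy_sum L nu :> int.
  have -> : (L * size (nu ord0))%N%:Z
      = \sum_a \sum_(j <- nu a) (L * (a == ord0))%N%:Z.
    rewrite (bigD1 ord0) //= [X in _ + X]big1 => [|a /negPf a0].
      rewrite addr0 muln1 big_const_seq count_predT iter_addr_0.
      by rewrite PoszM -mulr_natr natz.
    by rewrite big1 // => j _; rewrite a0 muln0.
  rewrite /vacancy_sum -sumrB; apply: eq_bigr => a _; rewrite exchange_big -sumrB.
  apply: eq_bigr => j _; rewrite /vacancy subKr; apply: eq_bigr => b _.
  by rewrite -mulr_sumr; congr (_ * _); elim/big_rec2: _ => // k y z _ ->.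
by rewrite E intrB intrD; field.
Qed.

Definition rigging_sum (nu : rigged) : int := \sum_a \sum_(y <- nu a) y.2.

(** The quadratic form in the charge is linear in the vacancy numbers of the
    rows, which makes its variation easy to follow. *)
Lemma charge_vacancy L nu : 2 * charge L nu =
  (rigging_sum nu + rigging_sum nu - (L * size (nu ord0))%N%:Z - vacancy_sum L (shape nu))%:~R.
Proof.
rewrite /charge mulrDr charge_config_vacancy /shape size_map -/(vacancy_sum _ _).
rewrite /rigging_sum; move: (\sum_a _) (vacancy_sum _ _) (L * _)%N => x y z.
rewrite !intrB !intrD; ring.
Qed.

Section Charge.
Variables (L : nat) (nu nu' : rigged) (x : nat -> vertex).
Variables (K : 'I_6 -> {mset row_label}%mset) (S : 'I_6 -> seq nat).
Hypotheses (L_gt0 : (0 < L)%N) (D : descent x S) (P : peel L nu nu' K S).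

Local Notation p a i := (vacancy L (shape nu) a i).
Local Notation p' a i := (vacancy L.-1 (shape nu') a i).

Lemma size_peel : size (nu ord0) = (size (nu' ord0) + count_mem 1%N (S ord0))%N.
Proof.
have := perm_size (shape_top P ord0); have := perm_size (shape_bot P ord0).
rewrite !size_cat !size_map => -> ->; rewrite -addnA size_filter; congr (_ + _)%N.
elim: (S ord0) (descent_pos D ord0) => //= j s IH.
rewrite inE negb_or => /andP[j0 /IH ->].
by case: j j0 => [|[|j]] //= _; rewrite ?add0n ?addnS.
Qed.

Lemma vacancy_step a i : (0 < i)%N -> p a i - p a i.-1 =
  - \sum_b C a b * (\sum_(k <- shape nu b) (i <= k))%N%:Z.
Proof.
case: i => // i _; have E (u v w : int) : (u - v) - (u - w) = - (v - w) by ring.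
rewrite /vacancy /= E -sumrB; congr (- _).
apply: eq_bigr => b _; rewrite -mulrBr; congr (_ * _).
elim: (shape nu b) => [|k s IH]; first by rewrite !big_nil.
by rewrite !big_cons !PoszD; lia.
Qed.

(** The symmetry of the quadratic form: the change of the vacancy numbers of
    the rows of nu caused by the selected rows equals the change of those of the
    selected rows caused by the rows of nu. *)
Lemma sum_vacancy_step :
  \sum_a \sum_(i <- S a) (p a i - p a i.-1) =
  \sum_a \sum_(k <- shape nu a) pairing a (x k) - (size (nu ord0))%:Z.
Proof.
have -> : (size (nu ord0))%:Z = \sum_a \sum_(k <- shape nu a) (a == ord0)%:R :> int.
  rewrite (bigD1 ord0) //= [X in _ + X]big1 => [|a /negPf a0].
    rewrite addr0 big_const_seq count_predT iter_addr_0 size_map.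
    exact/esym/natz.
  by rewrite big1 // => j _; rewrite a0.
have E a i : i \in S a -> p a i - p a i.-1
    = - \sum_b C a b * (\sum_(k <- shape nu b) (i <= k))%N%:Z.
  move=> ia; apply: vacancy_step; case: i ia => //.
  by rewrite (negPf (descent_pos D a)).
under eq_bigr => a _ do rewrite (eq_big_seq _ (E a)) sumrN exchange_big /=.
rewrite -sumrB sumrN exchange_big /= -sumrN; apply: eq_bigr => b _.
rewrite -sumrB; under [RHS]eq_bigr => k _ do rewrite (pairing_descent _ _ D) addrAC subrr sub0r.
rewrite sumrN exchange_big /=; congr (- _); apply: eq_bigr => a _.
rewrite -!mulr_sumr cartanC; congr (_ * _).
under [RHS]eq_bigr => k _ do rewrite (count_upto _ (descent_pos D a)).
elim: (S a) => [|j s IH]; first by rewrite big_nil big1 // => k _; rewrite big_nil.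
rewrite big_cons IH; under [RHS]eq_bigr => k _ do rewrite big_cons PoszD.
rewrite big_split /=; congr (_ + _).
by elim/big_rec2: _ => // k u v _ <-.
Qed.

Lemma sum_shape_top (F : 'I_6 -> nat -> int) :
  \sum_a \sum_(j <- shape nu a) F a j
  = \sum_a \sum_(y <- K a) F a y.1 + \sum_a \sum_(i <- S a) F a i.
Proof.
rewrite -big_split; apply: eq_bigr => a _.
by rewrite (perm_big _ (shape_top P a)) big_cat big_map.
Qed.

Lemma sum_shape_bot (F : 'I_6 -> nat -> int) :
  \sum_a \sum_(j <- shape nu' a) F a j
  = \sum_a \sum_(y <- K a) F a y.1 + \sum_a \sum_(i <- shortened (S a)) F a i.
Proof.
rewrite -big_split; apply: eq_bigr => a _.
by rewrite (perm_big _ (shape_bot P a)) big_cat big_map.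
Qed.

Lemma sum_pred (F : 'I_6 -> nat -> int) :
  \sum_a \sum_(i <- S a) F a i.-1 = \sum_a \sum_(i <- shortened (S a)) F a i
    + \sum_a F a 0%N *+ count_mem 1%N (S a).
Proof.
rewrite -big_split; apply: eq_bigr => a _.
exact: sum_shortened (descent_pos D a).
Qed.

Lemma rigging_sum_peel (mu : rigged) (r : 'I_6 -> nat -> int) (T : 'I_6 -> seq nat) :
  (forall a, mu a = K a `+` seq_mset (rows (r a) (T a)))%mset ->
  rigging_sum mu
  = \sum_a \sum_(y <- K a) y.2 + \sum_a \sum_(i <- T a) r a i.
Proof.
move=> muE; rewrite /rigging_sum -big_split; apply: eq_bigr => a _ /=.
rewrite muE (perm_big _ (perm_msetD _ _)) big_cat /= (perm_big _ (perm_eq_seq_mset _)).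
by rewrite big_map.
Qed.

(** The kept rows, the selected rows and the rows of length 1 contribute
    multiples of the pairings along the chain.  Those of the kept rows cancel by
    sum_vacancy_step, the others by descent_norm, and twice the number of rows
    remains. *)
Lemma charge_peel : charge L nu - charge L.-1 nu' = - (size (nu ord0))%:R.
Proof.
(* doubled, to deal with integers *)
have half (u v : rat) : 2 * u = 2 * v -> u = v by move=> uv; lra.
apply: half; rewrite mulrBr !charge_vacancy -intrB mulrN.
rewrite (rigging_sum_peel (peel_top P)) (rigging_sum_peel (peel_bot P)).
rewrite /vacancy_sum sum_shape_top sum_shape_bot.
have only0 (c : int) : \sum_a (c *+ (a == ord0)) *+ count_mem 1%N (S a)
    = c *+ count_mem 1%N (S ord0).
  rewrite (bigD1 ord0) //= big1 ?addr0 // => a /negPf a0.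
  by rewrite a0 mul0rn.
have p0 a : p a 0%N = L%:Z *+ (a == ord0) by rewrite vacancy0 PoszM -mulr_natr natz.
have h0 a : pairing a (x 0%N) = 1 *+ (a == ord0).
  by rewrite (descent_start D) pairing_top.
have kept' : \sum_a \sum_(y <- K a) p' a y.1 =
    \sum_a \sum_(y <- K a) p a y.1 - \sum_a \sum_(y <- K a) pairing a (x y.1).
  rewrite -sumrB; apply: eq_bigr => a _; rewrite -sumrB; apply: eq_bigr => y _.
  exact: vacancy_peel L_gt0 D P a y.1.
have short' : \sum_a \sum_(i <- shortened (S a)) p' a i =
    \sum_a \sum_(i <- shortened (S a)) p a i
    - \sum_a \sum_(i <- shortened (S a)) pairing a (x i).
  rewrite -sumrB; apply: eq_bigr => a _; rewrite -sumrB; apply: eq_bigr => i _.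
  exact: vacancy_peel L_gt0 D P a i.
have := sum_vacancy_step; rewrite sum_shape_top.
under eq_bigr => a _ do rewrite sumrB.
rewrite sumrB (sum_pred (fun a i => p a i)).
under [X in _ - (_ + X)]eq_bigr => a _ do rewrite p0.
rewrite only0 => step; have := descent_norm D.
under eq_bigr => a _ do rewrite big_split.
rewrite big_split /= (sum_pred (fun a i => pairing a (x i))).
under [X in _ + (_ + X)]eq_bigr => a _ do rewrite h0.
rewrite only0 kept' short' => norm; move: step norm; rewrite size_peel.
have natE (m n : nat) : m%:Z *+ n = (m * n)%N%:Z.
  by rewrite -mulr_natr natz -PoszM.
rewrite (natE L) (natE 1%N) mul1n => step norm.
have LE : (L * (size (nu' ord0) + count_mem 1 (S ord0)))%N%:Z
   = (L.-1 * size (nu' ord0))%N%:Z + (size (nu' ord0))%:Z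
     + (L * count_mem 1%N (S ord0))%N%:Z.
  by rewrite mulnDr -{1}(prednK L_gt0) mulSn; lia.
set R := (_ + _)%N in step LE *.
have key (sSh sTh kh sTp sSp rK kp LR MR Ld R' d : int) :
    sSh + (sTh + d) = 0 -> sSp - (sTp + Ld) = kh + sSh - (R' + d) ->
    LR = MR + R' + Ld ->
    rK + sSp + (rK + sSp) - LR - (kp + sSp) -
      (rK + (sTp - sTh) + (rK + (sTp - sTh)) - MR - (kp - kh + (sTp - sTh)))
    = - ((R' + d) + (R' + d)) by lia.
rewrite [X in X%:~R](_ : _ = - (R%:Z + R%:Z)); last first.
  exact: (key _ _ _ _ _ _ _ _ _ _ (size (nu' ord0)) (count_mem 1%N (S ord0)) norm step LE).
by rewrite intrN intrD; ring.
Qed.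

End Charge.

(** * Energy and the number of rows *)

(** The singular rows of nu1 of length i + 1 are the selected rows of nu of length
    i + 2 and some kept rows, the latter only in colors that do not enter
    x i.+1.  The greedy second chain draws on exactly these rows, which gives
    both conditions of local_rule. *)
Lemma energy_chain L lam nu nu1 nu2 x K S x' K' S' : RC lam L.+1 nu ->
  descent x S -> peel L.+1 nu nu1 K S ->
  descent x' S' -> peel L nu1 nu2 K' S' -> top_saturated L nu1 x' K' ->
  forall i, energy (x' i) (x i.+1) = energy ord0 (x 1%N).
Proof.
move=> R D P D' P' sat'; have sat := RC_bot_saturated (ltn0Sn L) D P R.
elim=> [|i <-]; first by rewrite (descent_start D').
have [w xw nw] := descent_walk D i.+1; have [w' xw' nw'] := descent_walk D' i.
have mult a : (K' a (i.+1, vacancy L (shape nu1) a i.+1) + count_mem i.+1 (S' a)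
    = K a (i.+1, vacancy L (shape nu1) a i.+1) + count_mem i.+2 (S a))%N.
  have := mult_top P' a i.+1 (vacancy L (shape nu1) a i.+1).
  by rewrite (mult_bot P) //= eqxx !mul1n => ->.
symmetry; apply: local_rule xw xw' _ _ => a.
  by move=> /(sat a i.+1 isT) /= K0; rewrite nw nw'; move: (mult a); rewrite K0; lia.
by move=> /(sat' a i.+1 isT) K0; rewrite nw nw'; move: (mult a); rewrite K0; lia.
Qed.

Lemma energy_first x S : descent x S ->
  energy ord0 (x 1%N) = - (count_mem 1%N (S ord0))%:Z.
Proof.
move=> D; have [w xw nw] := descent_walk D 0; rewrite energy_top.
rewrite (walk_content ord0 xw : content 0 _ = _) (descent_start D).
by rewrite content_top addn0 nw.
Qed.

(** Evaluating the constant of energy_chain at both ends. *)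
Lemma size_delta tie L lam nu : RC lam L.+2 nu ->
  (size (nu ord0))%:Z = (size (delta tie L.+2 nu ord0))%:Z
    - energy (gamma tie L.+1 (delta tie L.+2 nu)) (gamma tie L.+2 nu).
Proof.
move=> R; have [x [K [S [D P _ [N far]]]]] := delta_spec tie L.+2 nu.
have [x' [K' [S' [D' P' sat' [N' far']]]]] := delta_spec tie L.+1 (delta tie L.+2 nu).
rewrite (size_peel D P) -(far (maxn N N').+1); last by rewrite leqW ?leq_maxl.
rewrite -(far' (maxn N N')) ?leq_maxr //.
by rewrite (energy_chain R D P D' P' sat') (energy_first D) opprK.
Qed.

Lemma descent_content x S (a : 'I_6) i j : descent x S -> (i <= j)%N ->
  (content a (x i) <= content a (x j))%N.
Proof.
move=> D /subnK <-; elim: (j - i)%N => // k; rewrite addSn => /leq_trans; apply.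
have [w xw _] := descent_walk D (k + i).
by rewrite (walk_content a xw) leq_addl.
Qed.

(** After one step the configuration is empty, so gamma has a dominant weight
    and is the top vertex: nothing is selected. *)
Lemma size_RC1 lam nu : dominant lam -> RC lam 1 nu -> size (nu ord0) = 0%N.
Proof.
move=> dom R; pose tie : tie_break := fun _ _ _ => false.
have [dom' R'] := delta_RC tie (ltn0Sn 0) R.
have [E lam0] := RC0_empty dom' R'.
have [x [K [S [D P _ [N far]]]]] := delta_spec tie 1 nu.
have g1 : gamma tie 1 nu = ord0.
  apply: top_of_no_e => a ga; have := dom a.
  by have := weightB lam (gamma tie 1 nu) a; rewrite lam0 mxE ga; lia.
rewrite (size_peel D P) E ffunE enum_mset0 add0n.
apply/eqP; rewrite -leqn0; apply: leq_trans (_ : content 0 (x N.+1) <= 0)%N; last first.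
  by rewrite far // g1.
apply: leq_trans (descent_content ord0 D (ltn0Sn N)).
have [w xw nw] := descent_walk D 0; rewrite -nw.
by rewrite (walk_content ord0 xw) leq_addr.
Qed.

Lemma sum_pairs_rcons (F : vertex -> vertex -> int) (b : seq vertex) y z :
  let w := rcons (rcons b y) z in
  \sum_(j < (size b).+1) F (nth ord0 w j) (nth ord0 w j.+1)
  = \sum_(j < size b) F (nth ord0 (rcons b y) j) (nth ord0 (rcons b y) j.+1) + F y z.
Proof.
rewrite /= big_ord_recr /=; congr (_ + F _ _).
- apply: eq_bigr => j _; rewrite !(nth_rcons _ (rcons b y)) !size_rcons.
  by rewrite ltnS (ltnW (ltn_ord j)) ltnS ltn_ord.
- by rewrite !nth_rcons !size_rcons ltnSn ltnn eqxx.
- by rewrite !nth_rcons !size_rcons ltnn eqxx.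
Qed.

Lemma size_energy tie L lam nu : dominant lam -> RC lam L nu ->
  (size (nu ord0))%:Z = - \sum_(j < L.-1)
    energy (nth ord0 (Phi tie L nu) j) (nth ord0 (Phi tie L nu) j.+1).
Proof.
elim: L lam nu => [|[|L] IH] lam nu dom R.
- by have [-> _] := RC0_empty dom R; rewrite ffunE enum_mset0 big_ord0 oppr0.
- by rewrite (size_RC1 dom R) big_ord0 oppr0.
have [dom' R'] := delta_RC tie (ltn0Sn L.+1) R.
rewrite (size_delta tie R) (IH _ _ dom' R').
have := sum_pairs_rcons energy (Phi tie L (delta tie L.+1 (delta tie L.+2 nu)))
  (gamma tie L.+1 (delta tie L.+2 nu)) (gamma tie L.+2 nu).
rewrite size_tuple => /= E.
have {}E : \sum_(j < L.+2.-1) energy (nth ord0 (Phi tie L.+2 nu) j)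
      (nth ord0 (Phi tie L.+2 nu) j.+1)
  = \sum_(j < L.+1.-1) energy (nth ord0 (Phi tie L.+1 (delta tie L.+2 nu)) j)
      (nth ord0 (Phi tie L.+1 (delta tie L.+2 nu)) j.+1)
  + energy (gamma tie L.+1 (delta tie L.+2 nu)) (gamma tie L.+2 nu) := E.
by rewrite E opprD.
Qed.

Lemma energy_D_rcons H L (b : L.-tuple vertex) x :
  energy_D H (rcons_tuple b x) = energy_D H b
    + \sum_(j < L) H (nth ord0 (rcons b x) j) (nth ord0 (rcons b x) j.+1).
Proof.
case: L b => [|L] b; first by rewrite /energy_D !big_ord0.
rewrite /energy_D /= [X in _ = X + _](_ : _ = \sum_(j < L.+1)
  (L.+1 - j.+1)%N%:Z * H (nth ord0 (rcons b x) j) (nth ord0 (rcons b x) j.+1)).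
  rewrite -big_split; apply: eq_bigr => j _ /=.
  by rewrite subSn // intS; ring.
rewrite [RHS]big_ord_recr /= subnn mul0r addr0; apply: eq_bigr => j _.
by rewrite !nth_rcons !size_tuple ltnS (ltnW (ltn_ord j)) ltnS ltn_ord.
Qed.

Lemma charge_energy tie L lam nu : dominant lam -> RC lam L nu ->
  charge L nu = (energy_D energy (Phi tie L nu))%:~R.
Proof.
elim: L lam nu => [|L IH] lam nu dom R.
  have [-> _] := RC0_empty dom R.
  have nil a : shape [ffun=> mset0] a = [::] by rewrite /shape ffunE enum_mset0.
  rewrite /energy_D big_ord0 /charge /charge_config mul0n subr0.
  rewrite big1 => [|a _]; last first.
    by rewrite big1 // => b _; rewrite nil big_nil.
  rewrite big1 ?mulr0 ?addr0 // => a _.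
  by rewrite ffunE enum_mset0 big_nil.
have [dom' R'] := delta_RC tie (ltn0Sn L) R.
have [x [K [S [D P _ _]]]] := delta_spec tie L.+1 nu.
have := charge_peel (ltn0Sn L) D P; rewrite [L.+1.-1]/= (IH _ _ dom' R').
have := energy_D_rcons energy (Phi tie L (delta tie L.+1 nu)) (gamma tie L.+1 nu).
have -> : rcons_tuple (Phi tie L (delta tie L.+1 nu)) (gamma tie L.+1 nu)
  = Phi tie L.+1 nu by [].
move=> ->; rewrite intrD.
have -> : \sum_(j < L) energy
    (nth ord0 (rcons (Phi tie L (delta tie L.+1 nu)) (gamma tie L.+1 nu)) j)
    (nth ord0 (rcons (Phi tie L (delta tie L.+1 nu)) (gamma tie L.+1 nu)) j.+1)
  = - (size (nu ord0))%:Z by rewrite (size_energy tie dom R) opprK.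
by rewrite intrN; lra.
Qed.

(** For L = 0 the truncated L.-1 spoils the vacancy formula, but nothing can be
    selected anyway. *)
Lemma full_run_empty tie : full_run tie 0 [ffun=> mset0] = (ord0, [::]).
Proof.
have [l [sel -> [I _]]] := full_runP tie 0 [ffun=> mset0].
have sel0 : sel = [::].
  case: sel I => // -[a i] sel I; have := inv_count I a i.
  by rewrite /singular ffunE mset0E /= eqxx.
by have := inv_walk I; rewrite sel0 => -[<-].
Qed.

Lemma Phi_tie tie tie' L nu : Phi tie L nu = Phi tie' L nu.
Proof.
elim: L nu => // L IH nu; have [Eg Ed] := delta_tie tie tie' nu (ltn0Sn L).
by apply: val_inj; rewrite [LHS]/= [RHS]/= Eg Ed IH.
Qed.

Theorem theorem3p2 (H : vertex -> vertex -> int) (HH : is_energy H)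
    (L : nat) (lam : weight) (dom_lam : dominant lam) :
  (forall tie : tie_break,
     [/\ (0 < L)%N -> forall nu, RC lam L nu ->
           dominant (lam - wt (gamma tie L nu)) /\
           RC (lam - wt (gamma tie L nu)) L.-1 (delta tie L nu),
         set_bij (RC lam L) (paths lam L) (Phi tie L)
       & forall nu, RC lam L nu ->
           charge L nu = (energy_D H (Phi tie L nu))%:~R])
  /\ (forall (tie tie' : tie_break) nu, RC lam L nu ->
        [/\ gamma tie L nu = gamma tie' L nu,
            delta tie L nu = delta tie' L nu
          & Phi tie L nu = Phi tie' L nu]).
Proof.
split=> [tie|tie tie' nu R].
  split=> [L0 nu R||nu R]; first exact: delta_RC.
    exact: Phi_bij.
  rewrite (charge_energy tie dom_lam R); congr _%:~R.
  by apply: eq_bigr => j _; rewrite (energy_unique HH).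
case: (posnP L) => [L0|L0]; last first.
  by have [Eg Ed] := delta_tie tie tie' nu L0; split=> //; apply: Phi_tie.
rewrite {}L0 in R *; have [-> _] := RC0_empty dom_lam R.
split; last exact: Phi_tie.
  by rewrite /gamma !full_run_empty.
by rewrite /delta !full_run_empty.
Qed.
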